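(* Let $s\ge1$. Whatever the choice of the abscissae $c_1,\dots,c_s$, the method HBVM$(\infty,s)$ has order $2s$ and is perfectly $A$-stable.
   Context: Problem: $\dot y=f(y)$, $y(t_0)=y_0\in\mathbb R^{2m}$, with $f(y)=J\nabla H(y)$, $J$ a constant skew-symmetric matrix and $H$ sufficiently differentiable. Basis: $P_j$ ($j=1,\dots,s$) is the shifted Legendre polynomial of degree $j-1$ on $[0,1]$ (orthogonal on $[0,1]$), with $\int_0^1P_j^2(x)\,dx=(2j-1)^{-1}$. Abscissae: $c_1,\dots,c_s$ are distinct with $0<c_i\le1$. Set $a_{ij}=\int_0^{c_i}P_j(x)\,dx$, $i,j=1,\dots,s$. Method: HBVM$(\infty,s)$ (the Infinity Hamiltonian Boundary Value Method) with stepsize $h$ is the one-step method in which one looks for a polynomial $\sigma$ of degree at most $s$ (with vector coefficients) with $\sigma(t_0)=y_0$ whose values $Y_i=\sigma(t_0+c_ih)$ satisfy $$Y_i=y_0+h\int_0^1\left(\sum_{j=1}^s(2j-1)\,a_{ij}P_j(\tau)\right)J\nabla H(\sigma(t_0+\tau h))\,d\tau,\qquad i=1,\dots,s,$$ and the new approximation to $y(t_0+h)$ is $y_1=\sigma(t_0+h)$. Equivalently, $\sigma$ satisfies $$\sigma(t_0+ch)=y_0+h\sum_{j=1}^s(2j-1)\int_0^cP_j(x)\,dx\int_0^1P_j(\tau)f(\sigma(t_0+\tau h))\,d\tau,\qquad c\in[0,1].$$ Order $2s$ is meant in the classical sense for one-step methods (local error $y_1-y(t_0+h)=O(h^{2s+1})$).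 Perfect $A$-stability: when the method is applied with $f(y)=\lambda y$ in place of $J\nabla H(y)$, so that $y_1=R(q)y_0$ with $q=h\lambda\in\mathbb C$, the region of absolute stability $\{q\in\mathbb C:|R(q)|<1\}$ coincides with the open left half-plane $\{q\in\mathbb C:\operatorname{Re}q<0\}$. *)

(* Defs.v *)
From HB Require Import structures.
From mathcomp Require Import all_boot all_order all_algebra.
From mathcomp Require Import complex.
From mathcomp Require Import all_classical all_reals all_analysis.

Set Implicit Arguments.
Unset Strict Implicit.
Unset Printing Implicit Defensive.

Import Order.TTheory GRing.Theory Num.Theory.
Import numFieldNormedType.Exports.

Local Open Scope classical_set_scope.
Local Open Scope ring_scope.

(* Shifted Legendre polynomial of degree n on [0,1], by Rodrigues' formula
   (1/n!) (d/dx)^n (x^2 - x)^n; the squared L^2-norm is 1/(2n+1).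
   Since indices start at 0, it is the P_(n+1) of the usual 1-based numbering
   in which P_j has degree j-1 and squared norm 1/(2j-1). *)
Definition legendre (R : realType) (n : nat) : {poly R} :=
  (('X^2 - 'X) ^+ n)^`N(n).

Definition legendre_int (R : realType) (s : nat) (c : 'I_s -> R)
    (i j : 'I_s) : R :=
  \int[lebesgue_measure]_(x in `[0, c i]) (legendre R j).[x].

Definition poly_fun_le (R : realType) (V : lmodType R) (s : nat)
    (sigma : R -> V) : Prop :=
  exists v : 'I_s.+1 -> V,
    forall t, sigma t = \sum_(k < s.+1) (t ^+ k) *: v k.

Definition int01_cV (R : realType) (n : nat) (g : R -> 'cV[R]_n) : 'cV[R]_n :=
  \col_i \int[lebesgue_measure]_(x in `[0, 1]) (g x i 0).

(* Rcomplex R is R[i] with its structure of R-vector space. *)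
Definition int01_C (R : realType) (g : R -> Rcomplex R) : Rcomplex R :=
  Complex (\int[lebesgue_measure]_(x in `[0, 1]) complex.Re (g x))
          (\int[lebesgue_measure]_(x in `[0, 1]) complex.Im (g x)).

(* sigma is a polynomial produced by HBVM(oo,s) with abscissae c and stepsize h
   for y' = f y, y t0 = y0; the new approximation is sigma (t0 + h).
   int01 is integration over [0,1] of functions with values in V; it is a
   parameter so that the same method applies to R^n and to the complex scalar
   test equation.  The weight 2j+1 is 2(j+1)-1, see legendre. *)
Definition hbvm (R : realType) (V : lmodType R) (int01 : (R -> V) -> V)
    (f : V -> V) (s : nat) (c : 'I_s -> R) (t0 h : R) (y0 : V)
    (sigma : R -> V) : Prop :=
  [/\ poly_fun_le s sigma,
      sigma t0 = y0 &
      forall i : 'I_s,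
        sigma (t0 + c i * h) = y0 + h *: int01 (fun tau =>
          (\sum_(j < s) (2 * j + 1)%:R * legendre_int c i j
                        * (legendre R j).[tau])
            *: f (sigma (t0 + tau * h)))].

Definition partial (R : realType) (n : nat) (i : 'I_n) (H : 'cV[R]_n -> R) :
    'cV[R]_n -> R :=
  fun x => 'D_(delta_mx i 0) H x.

Definition grad (R : realType) (n : nat) (H : 'cV[R]_n -> R) (x : 'cV[R]_n) :
    'cV[R]_n :=
  \col_i partial i H x.

(* H is of class C^k: all iterated partial derivatives of order at most k exist
   and are continuous. *)
Fixpoint class_C (R : realType) (n k : nat) (H : 'cV[R]_n -> R) : Prop :=
  continuous H /\
  if k is k'.+1 then
    forall i : 'I_n,
      (forall x, derivable H x (delta_mx i 0)) /\ class_C k' (partial i H)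
  else True.

(* Order p: for every Hamiltonian problem with f = J grad H of class C^p and
   every solution y, the local error is O(h^(p+1)) as h -> 0+.  The method being
   implicit, this includes that sigma exists for all small h, and the
   error bound concerns every sigma that stays in a fixed (arbitrarily large)
   ball around y0: without a bound, a nonlinear f may admit spurious sigma
   that escape to infinity as h -> 0. *)
Definition hbvm_order (R : realType) (s : nat) (c : 'I_s -> R) (p : nat) :
    Prop :=
  forall (m : nat) (J : 'M[R]_(2 * m)) (H : 'cV[R]_(2 * m) -> R),
    J^T = - J -> class_C p.+1 H ->
  let f := fun x => J *m grad H x in
  forall (t0 T : R) (y0 : 'cV[R]_(2 * m)) (y : R -> 'cV[R]_(2 * m)),
    0 < T -> y t0 = y0 ->
    (forall t : R, t \in `]t0 - T, t0 + T[ -> is_derive t 1 y (f (y t))) ->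
  forall r : R, 0 < r ->
  let solution (h : R) (sigma : R -> 'cV[R]_(2 * m)) :=
    hbvm (@int01_cV R (2 * m)) f c t0 h y0 sigma /\
    (forall tau : R, tau \in `[0, 1] -> `|sigma (t0 + tau * h) - y0| <= r) in
  exists h0 C : R, [/\ 0 < h0, h0 < T &
    forall h : R, 0 < h <= h0 ->
      (exists sigma, solution h sigma) /\
      (forall sigma, solution h sigma ->
         `|sigma (t0 + h) - y (t0 + h)| <= C * h ^+ p.+1)].

(* q is not a pole of the stability function R of the method, and z = R(q):
   applied to y' = lam y with h lam = q, the method has a solution from every
   initial value and always gives y1 = z y0. *)
Definition stability_value (R : realType) (s : nat) (c : 'I_s -> R)
    (q z : R[i]) : Prop :=
  forall (t0 h : R) (lam y0 : R[i]), 0 < h -> real_complex R h * lam = q ->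
  let solution := hbvm (@int01_C R) (fun y : R[i] => lam * y) c t0 h y0 in
  (exists sigma, solution sigma) /\
  (forall sigma, solution sigma -> sigma (t0 + h) = z * y0).

Definition stability_region (R : realType) (s : nat) (c : 'I_s -> R) :
    set R[i] :=
  [set q | exists2 z, stability_value c q z & `|z| < 1].

Definition perfectly_A_stable (R : realType) (s : nat) (c : 'I_s -> R) : Prop :=
  stability_region c = [set q : R[i] | complex.Re q < 0].

(* Main.v *)
Require Import Defs.
From HB Require Import structures.
From mathcomp Require Import all_boot all_order all_algebra.
From mathcomp Require Import all_classical all_reals all_analysis.
From mathcomp Require Import complex ring lra.
Import Order.TTheory GRing.Theory Num.Theory.
Import numFieldNormedType.Exports.
Local Open Scope classical_set_scope.
Local Open Scope ring_scope.

Set Implicit Arguments.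
Unset Strict Implicit.
Unset Printing Implicit Defensive.

(** Write sigma (t0 + x h) = u x for x in [0, 1], and let Pi be the orthogonal
    projection of L^2([0, 1]) onto the polynomials of degree less than s.
    The s conditions at the abscissae, together with u 0 = y0, involve two
    polynomials of degree at most s, so they hold at the s + 1 points 0, c_1,
    ..., c_s if and only if the polynomials are equal (collocation).  Hence
    the method reads

      u' = h Pi (f u),  u 0 = y0,

    and the abscissae have disappeared.

    Stability.  For f y = lam y and q = h lam the method is u' = q Pi u.  As u'
    has degree less than s, the integral of (|u|^2)' = 2 Re (u' conj u) only
    sees Pi u (test_sol_energy):

      |u 1|^2 - |u 0|^2 = 2 Re q * ||Pi u||^2.

    The stability function is R q = u 1 / u 0.  If |R q| < 1, the identity
    forces Re q < 0.  Conversely, if Re q < 0, a solution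
    with u 0 = 0 has Pi u = 0, so u = 0; the linear system for u is thus
    uniquely solvable (test_sol_exists), and for u 0 = 1 the projection Pi u
    cannot vanish, since u would be the constant 1 = Pi 1; so |R q| < 1.

    Order.  For small h the method has a solution, by the contraction principle
    applied to the Legendre coefficients of f u (hbvm_exists).  Let y x stand
    for the exact solution at t0 + x h, and e = u - y.  First,
    e' = h Pi (f u - f y) + h (Pi (f y) - f y).  The function f y is a
    polynomial of degree less than s up to O(h^s), by Taylor expansion, and Pi
    fixes such polynomials; this gives e = O(h^(s+1)) (stage_error), and O(h^s)
    for the defect rho = Pi (f u) - f u.

    The end point gains a factor h^s because rho is orthogonal to the
    polynomials of degree less than s.  To see it, let psi be a row vector of
    polynomials with psi' = - psi f'(y) + O(t^s) and psi 0 a unit vector; the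
    s-th Picard iterate for this adjoint equation, with f'(y) replaced by its
    Taylor polynomial, is one (adjoint_row).  Since the linearization of f at y
    has an error O(e^2),

      (psi (h x) e x)' = h psi (h x) rho x + O(h^(2s+2)),

    and psi (h x) is a polynomial of degree less than s in x up to O(h^s).  So
    psi h * e 1 = O(h^(2s+1)) (superconvergence), and psi h differs from the
    unit vector by O(h), which bounds e 1 itself (local_error).  The adjoint
    polynomials psi play the part that the derivative of the flow with respect
    to the initial value has in the nonlinear variation of constants formula. *)

(** * Antiderivatives of polynomials *)
Section Primitive.
Context {F : numFieldType}.
Implicit Types p q : {poly F}.

(** The coefficient at i = 0 is p`_0 / 0 = 0: the inverse of 0 is 0. *)
Definition antideriv p : {poly F} := \poly_(i < (size p).+1) (p`_i.-1 / i%:R).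

Lemma coef_antideriv p i : (antideriv p)`_i = p`_i.-1 / i%:R.
Proof.
rewrite coef_poly; case: ltnP => // sp; rewrite nth_default ?mul0r//.
by case: i sp.
Qed.

Lemma size_antideriv p : (size (antideriv p) <= (size p).+1)%N.
Proof. exact: size_poly. Qed.

Fact antideriv_is_linear : linear antideriv.
Proof.
by move=> a p q; apply/polyP => i; rewrite coefD coefZ !coef_antideriv coefD coefZ mulrDl mulrA.
Qed.

HB.instance Definition _ :=
  GRing.isLinear.Build F {poly F} {poly F} _ antideriv antideriv_is_linear.

Lemma antideriv_horner0 p : (antideriv p).[0] = 0.
Proof. by rewrite horner_coef0 coef_antideriv invr0 mulr0. Qed.

Lemma deriv_antideriv p : (antideriv p)^`() = p.
Proof.
apply/polyP => i; rewrite coef_deriv coef_antideriv/= -[_ *+ _]mulr_natr divfK//.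
Qed.

Lemma antideriv_deriv p : antideriv p^`() = p - (p.[0])%:P.
Proof.
apply/polyP => -[|i]; rewrite coef_antideriv coefB coefC horner_coef0 ?invr0 ?mulr0 ?subrr//.
by rewrite /= coef_deriv subr0 -[p`_i.+1 *+ _]mulr_natr mulfK// pnatr_eq0.
Qed.

(** The formal integral over [0, 1]; see int01_horner. *)
Definition polyint p : F := (antideriv p).[1].

Fact polyint_is_linear : linear_for *%R polyint.
Proof. by move=> a p q; rewrite /polyint linearP/= hornerD hornerZ. Qed.

HB.instance Definition _ :=
  GRing.isLinear.Build F {poly F} F _ polyint polyint_is_linear.

Lemma polyint_deriv p : polyint p^`() = p.[1] - p.[0].
Proof. by rewrite /polyint antideriv_deriv hornerD hornerN hornerC. Qed.

Lemma polyint_by_parts p q :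
  polyint (p^`() * q) = (p * q).[1] - (p * q).[0] - polyint (p * q^`()).
Proof. by rewrite -polyint_deriv derivM linearD/= addrK. Qed.

End Primitive.

(** * Shifted Legendre polynomials *)
Section Legendre.
Context {R : realType}.
Implicit Types p q : {poly R}.

Let u : {poly R} := 'X^2 - 'X.

Let size_u : size u = 3%N.
Proof. by rewrite /u size_polyDl ?size_polyXn// size_polyN size_polyX. Qed.

Let u_monic : u \is monic.
Proof.
by rewrite monicE lead_coefDl ?size_polyXn ?size_polyN ?size_polyX// lead_coefXn.
Qed.

Let size_un n : size (u ^+ n) = (2 * n).+1.
Proof.
have un0 : u ^+ n != 0 by rewrite monic_neq0// monic_exp.
by rewrite -[LHS]prednK ?lt0n ?size_poly_eq0// size_exp size_u.
Qed.

(** Each derivative lowers the order of a zero by at most one. *)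
Lemma derivn_root_exp a n k p : (k <= n)%N ->
  exists r : {poly R}, (('X - a%:P) ^+ n * p)^`(k) = ('X - a%:P) ^+ (n - k) * r.
Proof.
elim: k => [|k IH] kn; first by exists p; rewrite derivn0 subn0.
have [r er] := IH (ltnW kn).
rewrite -subnSK// in er.
exists ((n - k.+1).+1%:R *: r + ('X - a%:P) * r^`()).
rewrite derivnS er derivM deriv_exp derivXsubC mul1r /= exprSr scaler_nat.
by rewrite [RHS]mulrDr mulrA mulrnAl -mulrnAr.
Qed.

(** The end points are zeros of order n of u ^+ n, so integrating Rodrigues'
    formula by parts leaves no boundary terms. *)
Lemma derivn_bubble_end n k x : (k < n)%N -> (x == 0) || (x == 1) ->
  ((u ^+ n)^`(k)).[x] = 0.
Proof.
move=> kn x01.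
have [v ->] : exists v, u = ('X - x%:P) * v.
  case/orP: x01 => /eqP ->; [exists ('X - 1) | exists 'X]; rewrite /u ?polyC0 ?polyC1; ring.
rewrite exprMn; have [r ->] := derivn_root_exp x (v ^+ n) (ltnW kn).
by rewrite hornerM horner_exp hornerXsubC subrr expr0n subn_eq0 leqNgt kn mul0r.
Qed.

Lemma polyint_derivn_bubble n k q : (k <= n)%N ->
  polyint ((u ^+ n)^`(k) * q) = (-1) ^+ k * polyint (u ^+ n * q^`(k)).
Proof.
elim: k q => [|k IH] q kn; first by rewrite !derivn0 mul1r.
rewrite derivnS polyint_by_parts !hornerM !derivn_bubble_end ?eqxx ?orbT// !mul0r subrr sub0r.
by rewrite IH ?(ltnW kn)// exprS mulN1r mulNr -derivSn.
Qed.

Lemma polyint_legendreM n q :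
  n`!%:R * polyint (legendre R n * q) = (-1) ^+ n * polyint (u ^+ n * q^`(n)).
Proof.
by rewrite -polyint_derivn_bubble// nderivn_def mulr_natl -linearMn/= mulrnAl.
Qed.

Lemma legendre_orth n q : (size q <= n)%N -> polyint (legendre R n * q) = 0.
Proof.
move=> qn; have := polyint_legendreM n q.
rewrite derivn_poly0// mulr0 linear0 mulr0 => /eqP.
by rewrite mulf_eq0 pnatr_eq0 gtn_eqF ?fact_gt0//= => /eqP.
Qed.

(** The recursion in n is the vanishing of the integral of the derivative of
    (2 X - 1) u^(n+1), rewritten with (2 X - 1)^2 = 4 u + 1. *)
Lemma polyint_bubble n : polyint (u ^+ n) = (-1) ^+ n * (n`! ^ 2)%:R / (2 * n).+1`!%:R.
Proof.
elim: n => [|n IH]; first by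
  rewrite !expr0 -derivX polyint_deriv !hornerX subr0 muln0 fact0 mul1r divr1.
have : polyint (((2%:R *: 'X - 1) * u ^+ n.+1)^`()) = 0.
  by rewrite polyint_deriv /u !(hornerE, horner_exp) /= !(subrr, expr0n, expr1n)/= !mulr0 subrr.
have -> : ((2%:R *: 'X - 1) * u ^+ n.+1)^`() =
   (4 * n + 6)%:R *: (u ^+ n.+1) + (n.+1)%:R *: u ^+ n.
  rewrite derivM deriv_exp derivB derivZ derivX derivC /= /u derivB derivXn derivX /=.
  rewrite -!mul_polyC !polyCMn exprS.
  move: (_ ^+ n) => w; rewrite -mulr_natl natrD natrM -addn1 natrD.
  by ring.
rewrite linearD/= !linearZ/= IH => /eqP; rewrite addr_eq0 => /eqP e.
have -> : polyint (u ^+ n.+1) =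
    - (n.+1%:R * ((-1) ^+ n * (n`! ^ 2)%:R / (2 * n).+1`!%:R)) / (4 * n + 6)%:R.
  by rewrite -e mulrAC mulfV ?mul1r// pnatr_eq0 addn_eq0 andbF.
rewrite mulnS !add2n (factS n) (factS (2*n).+2) (factS (2*n).+1).
rewrite exprS; have n0 : 0 <= n%:R :> R by [].
have : (2 * n).+1`!%:R != 0 :> R by rewrite pnatr_eq0 gtn_eqF ?fact_gt0.
move: (_`!) (_`!) => a b b0.
have S3 : (2 * n).+3%:R = 2 * n%:R + 3 :> R by rewrite -addn3 natrD natrM.
have S2 : (2 * n).+2%:R = 2 * n%:R + 2 :> R by rewrite -addn2 natrD natrM.
have S1 : n.+1%:R = n%:R + 1 :> R by rewrite natr1.
rewrite -!mulnn !natrM natrD natrM S1 S2 S3.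
move: ((-1) ^+ n) => e'; move: (n%:R) n0 => m m0.
field.
by rewrite b0/=; apply/and3P; split; apply: lt0r_neq0; lra.
Qed.

End Legendre.

Section LegendreBasis.
Context {R : realType}.
Implicit Types p q : {poly R}.

Lemma size_legendre n : (size (legendre R n) <= n.+1)%N.
Proof.
apply/leq_sizeP => j nj; rewrite coef_nderivn nth_default ?mul0rn//.
have : (size (('X^2 - 'X : {poly R}) ^+ n) <= (2 * n).+1)%N.
  apply: leq_trans (size_poly_exp_leq _ _) _.
  by rewrite ltnS leq_mul2r size_polyDl ?size_polyXn ?orbT// size_polyN size_polyX.
by move/leq_trans; apply; rewrite mul2n -addnn -addnS leq_add2l.
Qed.

Lemma legendre_lead n : (legendre R n)`_n = 'C(n + n, n)%:R.
Proof.
rewrite coef_nderivn; congr (_ *+ _).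
have -> : 'X^2 - 'X = ('X - 1%:P) * 'X :> {poly R} by rewrite polyC1; ring.
rewrite exprMn coefMXn ltnNge leq_addr/= addnK.
have /monicP := monic_exp n (monicXsubC (1 : R)).
by rewrite lead_coefE size_exp_XsubC.
Qed.

(** Take q = legendre R n in polyint_legendreM: its n-th derivative is a
    constant, and the integral of u ^+ n is a beta value. *)
Lemma polyint_legendre_sqr n :
  polyint (legendre R n * legendre R n) = ((2 * n).+1)%:R^-1.
Proof.
have f0 m : m`!%:R != 0 :> R by rewrite pnatr_eq0 gtn_eqF ?fact_gt0.
apply: (mulfI (f0 n)); rewrite polyint_legendreM.
have -> : (legendre R n)^`(n) = ('C(n + n, n) * n`!)%:R%:P.
  apply/polyP => i; rewrite coef_derivn coefC; case: eqP => [->|/eqP i0].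
    by rewrite addn0 legendre_lead ffactnn natrM mulr_natr.
  by rewrite nth_default ?mul0rn// (leq_trans (size_legendre n))// -addn1 leq_add2l lt0n.
rewrite [in LHS](mulrC (_ ^+ n : {poly R})) mul_polyC linearZ/= polyint_bubble.
have -> : (2 * n).+1`! = ((2 * n).+1 * ('C(n + n, n) * (n`! * n`!)))%N.
  by rewrite factS mul2n -addnn -(@bin_fact (n + n) n) ?leq_addr// addnK.
have : 'C(n + n, n)%:R != 0 :> R by rewrite pnatr_eq0 gtn_eqF// bin_gt0 leq_addr.
have := signrMK n (1 : R); rewrite mulr1 => e.
have : (2 * n).+1%:R != 0 :> R by rewrite pnatr_eq0.
rewrite -mulnn; move: (n`!) (f0 n) => a a0 k0 b0; rewrite !natrM.
move: ((-1) ^+ n) e a%:R a0 'C(_, _)%:R b0 (_.+1)%:R k0 => sg e {}a a0 b b0 k k0.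
transitivity (sg * sg * (a / k)); last by rewrite e mul1r.
by field; rewrite ?a0 ?b0 ?k0.
Qed.

Definition leg_sum s (g : 'I_s -> R) : {poly R} :=
  \sum_(j < s) ((2 * j + 1)%:R * g j) *: legendre R j.

(** The orthogonal projection of L^2([0, 1]), restricted to polynomials. *)
Definition leg_proj s p := leg_sum (fun j : 'I_s => polyint (legendre R j * p)).

Lemma size_leg_sum s (g : 'I_s -> R) : (size (leg_sum g) <= s)%N.
Proof.
apply: (leq_trans (size_sum _ _ _)); apply/bigmax_leqP => j _.
by rewrite (leq_trans (size_scale_leq _ _))// (leq_trans (size_legendre _)).
Qed.

Fact leg_proj_is_linear s : linear (leg_proj s).
Proof.
move=> a p q; rewrite /leg_proj /leg_sum scaler_sumr -big_split/=.
apply: eq_bigr => j _; rewrite mulrDr -scalerAr linearP/=.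
by rewrite scalerA -scalerDl mulrDr mulrCA.
Qed.

HB.instance Definition _ s :=
  GRing.isLinear.Build R {poly R} {poly R} _ (leg_proj s) (leg_proj_is_linear s).

Lemma leg_projS s p : leg_proj s.+1 p =
  leg_proj s p + ((2 * s + 1)%:R * polyint (legendre R s * p)) *: legendre R s.
Proof. by rewrite /leg_proj /leg_sum big_ord_recr. Qed.

Lemma leg_proj_legendre s : leg_proj s (legendre R s) = 0.
Proof.
rewrite /leg_proj /leg_sum big1// => j _.
by rewrite [X in polyint X]mulrC legendre_orth ?mulr0 ?scale0r// (leq_trans (size_legendre _)).
Qed.

(** Subtracting from p its component along legendre R s lowers the degree, as
    the latter has degree exactly s; induction applies to what remains. *)
Lemma leg_proj_id s p : (size p <= s)%N -> leg_proj s p = p.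
Proof.
elim: s p => [|s IH] p sp.
  by rewrite /leg_proj /leg_sum big_ord0; apply/esym/eqP; rewrite -size_poly_leq0.
have l0 : (legendre R s)`_s != 0.
  by rewrite legendre_lead pnatr_eq0 gtn_eqF// bin_gt0 leq_addr.
pose a := p`_s / (legendre R s)`_s.
have sr : (size (p - a *: legendre R s)%R <= s)%N.
  apply/leq_sizeP => i; rewrite leq_eqVlt => /predU1P[<-|si].
    by rewrite coefB coefZ divfK// subrr.
  rewrite coefB coefZ !nth_default ?mulr0 ?subrr//.
    by rewrite (leq_trans (size_legendre _)).
  by rewrite (leq_trans sp).
rewrite -[p](subrK (a *: legendre R s)); move: sr; set r := p - _ => sr.
rewrite linearD linearZ/= !leg_projS leg_proj_legendre add0r IH//.
rewrite legendre_orth// mulr0 scale0r addr0.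
by rewrite polyint_legendre_sqr addn1 divff ?scale1r// pnatr_eq0.
Qed.

Lemma polyint_leg_sumM s (g : 'I_s -> R) q :
  polyint (leg_sum g * q) = \sum_(j < s) (2 * j + 1)%:R * g j * polyint (legendre R j * q).
Proof.
rewrite /leg_sum mulr_suml linear_sum/=; apply: eq_bigr => j _.
by rewrite -scalerAl linearZ.
Qed.

(** The projection is self-adjoint and fixes q. *)
Lemma polyint_leg_projM s p q : (size q <= s)%N -> polyint (leg_proj s p * q) = polyint (p * q).
Proof.
move=> sq; rewrite -[in RHS](leg_proj_id sq) [in RHS]mulrC !polyint_leg_sumM.
by apply: eq_bigr => j _; ring.
Qed.

End LegendreBasis.

(** * Integrals over the unit interval *)
Section Integral01.
Context {R : realType}.
Implicit Types (f g : R -> R) (p : {poly R}).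

(** Continuity relative to [0, 1]: the exact solution is only controlled on a
    bounded interval. *)
Definition cont01 g := {within `[0, 1], continuous g}.
Definition int01 g : R := \int[lebesgue_measure]_(x in `[0, 1]) g x.

Lemma cont01_cst a : cont01 (fun=> a).
Proof. by move=> x; exact: cvg_cst. Qed.

Lemma cont01D f g : cont01 f -> cont01 g -> cont01 (fun x => f x + g x).
Proof. by move=> cf cg x; apply: cvgD; [exact: cf | exact: cg]. Qed.

Lemma cont01M f g : cont01 f -> cont01 g -> cont01 (fun x => f x * g x).
Proof. by move=> cf cg x; apply: cvgM; [exact: cf | exact: cg]. Qed.

Lemma cont01B f g : cont01 f -> cont01 g -> cont01 (fun x => f x - g x).
Proof. by move=> cf cg x; apply: cvgB; [exact: cf | exact: cg]. Qed.

Lemma cont01_sum (I : finType) (P : pred I) (F : I -> R -> R) :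
  (forall i, P i -> cont01 (F i)) -> cont01 (fun x => \sum_(i | P i) F i x).
Proof.
move=> cF; rewrite /cont01 (_ : (fun x => _) = \sum_(i | P i) F i); last first.
  by apply/funext => x; rewrite fct_sumE.
elim/big_ind : _ => //; first exact: cont01_cst.
by move=> f g; exact: cont01D.
Qed.

Lemma continuous_cont01 g : continuous g -> cont01 g.
Proof. exact: continuous_subspaceT. Qed.

Lemma cont01_horner p : cont01 (fun x => p.[x]).
Proof. by apply: continuous_cont01 => x; exact: continuous_horner. Qed.

Lemma cont01_integrable g : cont01 g ->
  lebesgue_measure.-integrable `[0, 1] (EFin \o g).
Proof.
by move=> cg; apply: continuous_compact_integrable => //; exact: segment_compact.
Qed.

Lemma eq_int01 f g : (forall x, 0 <= x <= 1 -> f x = g x) -> int01 f = int01 g.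
Proof.
by move=> fg; apply: eq_Rintegral => x; rewrite inE/= in_itv/= => /fg.
Qed.

Lemma int01D f g : cont01 f -> cont01 g -> int01 (fun x => f x + g x) = int01 f + int01 g.
Proof. by move=> cf cg; rewrite /int01 RintegralD//; exact: cont01_integrable. Qed.

Lemma int01B f g : cont01 f -> cont01 g -> int01 (fun x => f x - g x) = int01 f - int01 g.
Proof. by move=> cf cg; rewrite /int01 RintegralB//; exact: cont01_integrable. Qed.

Lemma int01Z a f : cont01 f -> int01 (fun x => a * f x) = a * int01 f.
Proof. by move=> cf; rewrite /int01 RintegralZl//; exact: cont01_integrable. Qed.

Lemma int01_cst a : int01 (fun=> a) = a.
Proof.
by rewrite /int01 Rintegral_cst//= lebesgue_measure_itv/= lte_fin ltr01 /= oppr0 addr0 mulr1.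
Qed.

Lemma int01_sum (I : finType) (P : pred I) (F : I -> R -> R) :
  (forall i, P i -> cont01 (F i)) ->
  int01 (fun x => \sum_(i | P i) F i x) = \sum_(i | P i) int01 (F i).
Proof.
move=> cF; rewrite (_ : (fun x => _) = \sum_(i | P i) F i); last first.
  by apply/funext => x; rewrite fct_sumE.
suff [] : cont01 (\sum_(i | P i) F i) /\
    int01 (\sum_(i | P i) F i) = \sum_(i | P i) int01 (F i) by [].
elim/big_ind2 : _ => [|f a g b [cf <-] [cg <-]|i /cF //].
  by split; [exact: cont01_cst | exact: int01_cst].
by split; [exact: cont01D | exact: int01D].
Qed.

Lemma int01_le f g : cont01 f -> cont01 g ->
  (forall x, 0 <= x <= 1 -> f x <= g x) -> int01 f <= int01 g.
Proof.
move=> cf cg fg; apply: le_Rintegral => //; try exact: cont01_integrable.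
Qed.

Lemma int01_norm g (M : R) : cont01 g -> (forall x, 0 <= x <= 1 -> `|g x| <= M) ->
  `|int01 g| <= M.
Proof.
move=> cg gM; rewrite ler_norml; apply/andP; split.
  by rewrite -(int01_cst (- M)); apply: int01_le => //;
    [exact: cont01_cst | move=> x /gM; rewrite ler_norml => /andP[]].
by rewrite -[leRHS](int01_cst M); apply: int01_le => //;
  [exact: cont01_cst | move=> x /gM; rewrite ler_norml => /andP[]].
Qed.

Lemma integral_FTC (b : R) (F f : R -> R) : 0 < b ->
  {within `[0, b], continuous F} -> {within `[0, b], continuous f} ->
  (forall x : R, 0 < x < b -> is_derive x 1 F (f x)) ->
  \int[lebesgue_measure]_(x in `[0, b]) f x = F b - F 0.
Proof.
move=> b0 cF cf dF; rewrite /Rintegral (@continuous_FTC2 _ f F 0 b)//.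
- have [_ cr cl] := (continuous_within_itvP F b0).1 cF; split => //.
  by move=> x; rewrite in_itv/= => /dF[].
- by move=> x; rewrite in_itv/= => /dF ?; rewrite derive1E derive_val.
Qed.

Lemma int01_FTC F f : cont01 F -> cont01 f ->
  (forall x : R, 0 < x < 1 -> is_derive x 1 F (f x)) -> int01 f = F 1 - F 0.
Proof. exact: integral_FTC. Qed.

Lemma integral_horner p (b : R) : 0 < b ->
  \int[lebesgue_measure]_(x in `[0, b]) p.[x] = (antideriv p).[b].
Proof.
move=> b0; transitivity ((antideriv p).[b] - (antideriv p).[0]); last first.
  by rewrite antideriv_horner0 subr0.
apply: (@integral_FTC b (horner (antideriv p)) (horner p)) => //.
- by apply: continuous_subspaceT => x; exact: continuous_horner.
- by apply: continuous_subspaceT => x; exact: continuous_horner.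
- by move=> x _; have := is_derive_poly (antideriv p) x; rewrite deriv_antideriv.
Qed.

Lemma int01_horner p : int01 (horner p) = polyint p.
Proof. exact: integral_horner. Qed.

(** * Collocation conditions *)

(** Legendre coefficient of g, without the factor 2j + 1. *)
Definition leg_moment (g : R -> R) (j : nat) : R := int01 (fun x => (legendre R j).[x] * g x).

(** Both sides of the last equation are polynomials of degree at most s that
    agree at 0, so they are equal as soon as they agree at s other points: every
    choice of the abscissae defines the same method. *)
Lemma collocation s (c : 'I_s -> R) (u : {poly R}) a (g : 'I_s -> R) :
  injective c -> (forall i, 0 < c i <= 1) -> (size u <= s.+1)%N -> u.[0] = a ->
  (forall i, u.[c i] = a + \sum_(j < s) (2 * j + 1)%:R * legendre_int c i j * g j) <->
  u = a%:P + antideriv (leg_sum g).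
Proof.
move=> c_inj c_range su u0.
have key i : (a%:P + antideriv (leg_sum g)).[c i] =
    a + \sum_(j < s) (2 * j + 1)%:R * legendre_int c i j * g j.
  rewrite hornerD hornerC /leg_sum linear_sum/= horner_sum; congr (_ + _).
  apply: eq_bigr => j _; have /andP[c0 _] := c_range i.
  by rewrite linearZ/= hornerZ /legendre_int integral_horner// mulrAC.
split=> [uc|-> i]; last by rewrite key.
apply/eqP; rewrite -subr_eq0; apply/eqP; set w := _ - _.
apply: (@roots_geq_poly_eq0 _ w (0 :: codom c)).
- rewrite /= /root /w hornerD hornerN u0 hornerD hornerC antideriv_horner0 addr0 subrr eqxx /=.
  by apply/allP => _ /codomP[i ->]; rewrite /root hornerD hornerN uc key subrr.
- rewrite /= map_inj_uniq ?enum_uniq// andbT; apply/codomP => -[i e].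
  by have := c_range i; rewrite -e ltxx.
- rewrite /= size_codom card_ord (leq_trans (size_polyD _ _))// size_polyN geq_max su/=.
  rewrite (leq_trans (size_polyD _ _))// geq_max (leq_trans (size_polyC_leq1 _))//=.
  by rewrite (leq_trans (size_antideriv _))// ltnS size_leg_sum.
Qed.

End Integral01.

Section PolyFun.
Context {R : realType}.
Implicit Types (V : lmodType R).

(** Passage from the time t to the stage variable x = (t - t0) / h, for one
    coordinate phi. *)
Lemma poly_fun_le_horner V s (sigma : R -> V) (phi : V -> R) t0 h :
  linear_for *%R phi -> poly_fun_le s sigma ->
  exists2 p : {poly R}, (size p <= s.+1)%N &
    forall x, phi (sigma (t0 + x * h)) = p.[x].
Proof.
move=> phil [v sv].
have phi0 : phi 0 = 0.
  by have := phil (-1) 0 0; rewrite scaler0 addr0 mulN1r addNr.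
exists (\sum_(k < s.+1) phi (v k) *: (t0%:P + h *: 'X) ^+ k) => [|x].
  apply: (leq_trans (size_sum _ _ _)); apply/bigmax_leqP => k _.
  apply: (leq_trans (size_scale_leq _ _)); apply: (leq_trans (size_poly_exp_leq _ _)).
  apply: leq_ltn_trans (ltn_ord k); rewrite -[leqRHS]mul1n leq_mul2r.
  apply/orP; right; rewrite -subn1 leq_subLR (leq_trans (size_polyD _ _))// geq_max.
  by rewrite (leq_trans (size_polyC_leq1 _))//= (leq_trans (size_scale_leq _ _))// size_polyX.
rewrite sv horner_sum.
transitivity (\sum_(k < s.+1) phi ((t0 + x * h) ^+ k *: v k)).
  elim/big_rec2: _ => // k a b _ <-.
  by have := phil 1 ((t0 + x * h) ^+ k *: v k) b; rewrite scale1r mul1r.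
apply: eq_bigr => k _; have := phil ((t0 + x * h) ^+ k) (v k) 0.
rewrite !addr0 phi0 addr0 => ->.
by rewrite hornerZ horner_exp hornerD hornerC hornerZ hornerX mulrC (mulrC x).
Qed.

Lemma poly_fun_le_sum V s (I : finType) (F : I -> R -> V) :
  (forall i, poly_fun_le s (F i)) -> poly_fun_le s (fun t => \sum_i F i t).
Proof.
move=> /choice[v Fv]; exists (fun k => \sum_i v i k) => t.
under eq_bigr do rewrite Fv; rewrite exchange_big/=.
by apply: eq_bigr => k _; rewrite scaler_sumr.
Qed.

Lemma poly_fun_leD V s (f g : R -> V) :
  poly_fun_le s f -> poly_fun_le s g -> poly_fun_le s (fun t => f t + g t).
Proof.
move=> [v fv] [w gw]; exists (fun k => v k + w k) => t.
by rewrite fv gw -big_split/=; apply: eq_bigr => k _; rewrite scalerDr.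
Qed.

Lemma poly_fun_le_affine V s (p : {poly R}) (t0 h : R) (w : V) :
  (size p <= s.+1)%N -> poly_fun_le s (fun t => p.[(t - t0) / h] *: w).
Proof.
move=> sp; pose q := p \Po (h^-1 *: ('X - t0%:P)).
have sq : (size q <= s.+1)%N.
  rewrite (leq_trans (size_comp_poly_leq _ _))// ltnS.
  have : (size (h^-1 *: ('X - t0%:P) : {poly R}) <= 2)%N.
    by rewrite (leq_trans (size_scale_leq _ _))// size_XsubC.
  rewrite -subn1 -[in X in _ -> X]subn1 => h2.
  rewrite -[leqRHS]muln1 leq_mul// ?leq_subLR ?add1n//.
exists (fun k : 'I_s.+1 => q`_k *: w) => t.
rewrite -[_ / h]/(_ * _) (_ : p.[_] = q.[t]); last first.
  by rewrite horner_comp hornerZ hornerXsubC mulrC.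
rewrite (horner_coef_wide _ sq) scaler_suml.
by apply: eq_bigr => k _; rewrite scalerA mulrC.
Qed.

Lemma leg_moment_kernel s (l : 'I_s -> R) (w : R -> R) : cont01 w ->
  int01 (fun x => (\sum_(j < s) (2 * j + 1)%:R * l j * (legendre R j).[x]) * w x) =
  \sum_(j < s) (2 * j + 1)%:R * l j * leg_moment w j.
Proof.
move=> cw; rewrite /leg_moment.
under eq_int01 => x _ do rewrite mulr_suml.
have cPw j : cont01 (fun x : R => (legendre R j).[x] * w x).
  by apply: cont01M => //; exact: cont01_horner.
rewrite int01_sum => [|j _]; last first.
  by apply: cont01M => //; apply: cont01M; [exact: cont01_cst|exact: cont01_horner].
apply: eq_bigr => j _; rewrite -int01Z//; apply: eq_int01 => x _.
by rewrite mulrA.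
Qed.

Lemma leg_moment_horner (w : {poly R}) j : leg_moment (horner w) j = polyint (legendre R j * w).
Proof. by rewrite -int01_horner; apply: eq_int01 => x _; rewrite hornerM. Qed.

End PolyFun.

(** * The linear test equation *)
Section AStability.
Context {R : realType}.
Variable s : nat.
Implicit Types (a b x : R) (u : {poly R}).

Lemma polyint_legendre_comb (g : 'I_s -> R) (j : 'I_s) :
  polyint (legendre R j * leg_sum g) = g j.
Proof.
rewrite mulrC polyint_leg_sumM (bigD1 j)//= polyint_legendre_sqr big1 => [|k kj].
  by rewrite addr0 addn1 mulrAC divff ?mul1r// pnatr_eq0.
have : (k != j :> nat) by []; rewrite neq_ltn => /orP[kj'|kj'].
  by rewrite [X in polyint X]mulrC legendre_orth ?mulr0// (leq_trans (size_legendre _)).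
by rewrite legendre_orth ?mulr0// (leq_trans (size_legendre _)).
Qed.

Lemma polyint_leg_proj_sqr u : polyint (leg_proj s u * leg_proj s u) =
  \sum_(j < s) (2 * j + 1)%:R * polyint (legendre R j * u) ^+ 2.
Proof.
rewrite {1}/leg_proj polyint_leg_sumM; apply: eq_bigr => j _.
by rewrite polyint_legendre_comb expr2 mulrA.
Qed.

Lemma polyint_leg_proj_sqr_ge0 u : 0 <= polyint (leg_proj s u * leg_proj s u).
Proof.
by rewrite polyint_leg_proj_sqr; apply: sumr_ge0 => j _; rewrite mulr_ge0 ?sqr_ge0.
Qed.

Lemma polyint_leg_proj_sqr_eq0 u : polyint (leg_proj s u * leg_proj s u) = 0 -> leg_proj s u = 0.
Proof.
rewrite polyint_leg_proj_sqr => /eqP; rewrite psumr_eq0 => [/allP e|j _]; last first.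
  by rewrite mulr_ge0 ?sqr_ge0.
rewrite /leg_proj /leg_sum big1// => j _.
have := e j (mem_index_enum _); rewrite mulf_eq0 sqrf_eq0 => /implyP/(_ isT).
by rewrite pnatr_eq0 addn1/= => /eqP ->; rewrite mulr0 scale0r.
Qed.

Lemma leg_proj2 k l u v : leg_proj s (k *: u + l *: v) = k *: leg_proj s u + l *: leg_proj s v.
Proof. by rewrite linearP linearZ. Qed.

Lemma antideriv2 k l u v : antideriv (k *: u + l *: v) = k *: antideriv u + l *: antideriv v.
Proof. by rewrite linearP linearZ. Qed.

Lemma antideriv0 : antideriv (0 : {poly R}) = 0.
Proof. exact: linear0. Qed.

Lemma polyint2 k l u v : polyint (k *: u + l *: v) = k * polyint u + l * polyint v.
Proof. by rewrite linearP linearZ. Qed.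

(** Real and imaginary parts of u' = (a + i b) Pi u, u 0 = x1 + i x2, in
    integrated form. *)
Definition test_sol a b x1 x2 u1 u2 :=
  u1 = x1%:P + antideriv (leg_proj s (a *: u1 + (- b) *: u2)) /\
  u2 = x2%:P + antideriv (leg_proj s (b *: u1 + a *: u2)).

Lemma test_sol_lin a b x1 x2 y1 y2 u1 u2 v1 v2 (k l : R) :
  test_sol a b x1 x2 u1 u2 -> test_sol a b y1 y2 v1 v2 ->
  test_sol a b (k * x1 + l * y1) (k * x2 + l * y2)
    (k *: u1 + l *: v1) (k *: u2 + l *: v2).
Proof.
have swap (c d : R) (p1 p2 q1 q2 : {poly R}) :
    c *: (k *: p1 + l *: q1) + d *: (k *: p2 + l *: q2) =
    k *: (c *: p1 + d *: p2) + l *: (c *: q1 + d *: q2).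
  by rewrite -!mul_polyC; ring.
move=> [e1 e2] [e3 e4]; split; rewrite swap leg_proj2 antideriv2.
  by rewrite {1}e1 {1}e3 -!mul_polyC polyCD !polyCM; ring.
by rewrite {1}e2 {1}e4 -!mul_polyC polyCD !polyCM; ring.
Qed.

(** Multiplication of the solution by i. *)
Lemma test_sol_rot a b x1 x2 u1 u2 : test_sol a b x1 x2 u1 u2 ->
  test_sol a b (- x2) x1 (- u2) u1.
Proof.
move=> [e1 e2]; split.
  rewrite {1}e2 (_ : a *: - u2 + _ = - (b *: u1 + a *: u2)).
    by rewrite !linearN/= polyCN opprD.
  by rewrite -!mul_polyC polyCN; ring.
by rewrite {1}e1; congr (_ + antideriv (leg_proj s _)); rewrite -!mul_polyC polyCN; ring.
Qed.

(** The derivative of u has degree less than s, so in the integral of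
    (|u|^2)' = 2 Re (u' conj u) the factor u may be replaced by Pi u, and
    u' = (a + i b) Pi u. *)
Lemma test_sol_energy a b x1 x2 u1 u2 : test_sol a b x1 x2 u1 u2 ->
  u1.[1] ^+ 2 + u2.[1] ^+ 2 - (x1 ^+ 2 + x2 ^+ 2) =
  2 * a * (polyint (leg_proj s u1 * leg_proj s u1) + polyint (leg_proj s u2 * leg_proj s u2)).
Proof.
move=> [e1 e2].
have h1 : u1.[0] = x1 by rewrite e1 hornerD hornerC antideriv_horner0 addr0.
have h2 : u2.[0] = x2 by rewrite e2 hornerD hornerC antideriv_horner0 addr0.
have d1 : u1^`() = leg_proj s (a *: u1 + (- b) *: u2).
  by rewrite {1}e1 derivD derivC add0r deriv_antideriv.
have d2 : u2^`() = leg_proj s (b *: u1 + a *: u2).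
  by rewrite {1}e2 derivD derivC add0r deriv_antideriv.
have H u v : polyint (u * leg_proj s v) = polyint (leg_proj s u * leg_proj s v).
  by rewrite polyint_leg_projM// size_leg_sum.
have := polyint_deriv (u1 * u1 + u2 * u2); rewrite hornerD !hornerM [in X in _ - X]hornerD.
rewrite !hornerM h1 h2 !expr2 => <-.
have P k l (w v v' : {poly R}) : polyint (w * leg_proj s (k *: v + l *: v')) =
    k * polyint (leg_proj s w * leg_proj s v) + l * polyint (leg_proj s w * leg_proj s v').
  by rewrite leg_proj2 mulrDr -!scalerAr polyint2 (H w v) (H w v').
rewrite (_ : (u1 * u1 + u2 * u2)^`() = 2 *: (u1 * u1^`()) + 2 *: (u2 * u2^`())).
  by rewrite polyint2 d1 d2 !P (mulrC (leg_proj s u2) (leg_proj s u1)); ring.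
by rewrite derivD !derivM -!mul_polyC polyCMn; ring.
Qed.

(** The two sides of the energy identity have opposite signs, so Pi u = 0; then
    u' = 0. *)
Lemma test_sol_uniq a b u1 u2 : a < 0 -> test_sol a b 0 0 u1 u2 -> u1 = 0 /\ u2 = 0.
Proof.
move=> a0 su; have := test_sol_energy su; rewrite expr0n/= addr0 subr0 => e.
have p1 := polyint_leg_proj_sqr_ge0 u1; have p2 := polyint_leg_proj_sqr_ge0 u2.
have q1 := sqr_ge0 u1.[1]; have q2 := sqr_ge0 u2.[1].
have z : polyint (leg_proj s u1 * leg_proj s u1) +
  polyint (leg_proj s u2 * leg_proj s u2) = 0 by nra.
have /polyint_leg_proj_sqr_eq0 z1 : polyint (leg_proj s u1 * leg_proj s u1) = 0 by lra.
have /polyint_leg_proj_sqr_eq0 z2 : polyint (leg_proj s u2 * leg_proj s u2) = 0 by lra.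
case: su => e1 e2; split; [rewrite e1 | rewrite e2];
  by rewrite leg_proj2 z1 z2 !scaler0 addr0 polyC0 antideriv0 addr0.
Qed.

(** The unknown is v = Pi u, which solves v = Pi (x + antiderivative of
    (a + i b) v).  This is a linear system of size 2s, injective by uniqueness. *)
Lemma test_sol_exists a b x1 x2 : a < 0 -> exists u1 u2, test_sol a b x1 x2 u1 u2.
Proof.
move=> a0.
pose U := ('rV[R]_s * 'rV[R]_s)%type.
pose G (c d : R) (v : U) : 'rV[R]_s :=
  poly_rV (leg_proj s (antideriv (c *: rVpoly v.1 + d *: rVpoly v.2))).
have Glin c d : linear (G c d).
  move=> k v w; rewrite /G -linearP -linearP -linearP.
  congr (poly_rV (leg_proj s (antideriv _))).
  by rewrite !linearP/= -!mul_polyC; ring.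
pose F (v : U) : U := (v.1 - G a (- b) v, v.2 - G b a v).
have Flin : linear F.
  by move=> k v w; rewrite /F !Glin; congr pair => /=;
    rewrite scalerBr opprD !addrA; congr (_ + _); rewrite addrAC.
pose FL : {linear U -> U} := HB.pack F (GRing.isLinear.Build R U U _ F Flin).
have GE c d v : rVpoly (G c d v) = leg_proj s (antideriv (c *: rVpoly v.1 + d *: rVpoly v.2)).
  by rewrite poly_rV_K// size_leg_sum.
have kF : lker (linfun FL) == 0%VS.
  apply/eqP/vspaceP => v; rewrite memv_ker memv0 lfunE/=; apply/eqP/eqP => [|->]; last first.
    exact: (linear0 FL).
  rewrite /F => -[/eqP]; rewrite subr_eq0 => /eqP e1 /eqP; rewrite subr_eq0 => /eqP e2.
  have E1 := GE a (- b) v; have E2 := GE b a v; rewrite -e1 in E1; rewrite -e2 in E2.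
  have [|z1 z2] := @test_sol_uniq a b (antideriv (a *: rVpoly v.1 + (- b) *: rVpoly v.2))
      (antideriv (b *: rVpoly v.1 + a *: rVpoly v.2)) a0.
    by split; rewrite polyC0 add0r leg_proj2 -E1 -E2.
  rewrite z1 linear0 in E1; rewrite z2 linear0 in E2.
  case: v {e1 e2 z1 z2} E1 E2 => v1 v2 /= E1 E2.
  by congr pair; rewrite -[LHS](rVpolyK) ?E1 ?E2 linear0.
pose y : U := (poly_rV (leg_proj s x1%:P), poly_rV (leg_proj s x2%:P)).
have := lker0_lfunVK kF y; rewrite lfunE/=; move: ((linfun FL)^-1%VF y) => v.
rewrite /F => -[/eqP]; rewrite subr_eq => /eqP e1 /eqP; rewrite subr_eq => /eqP e2.
pose w1 := a *: rVpoly v.1 + (- b) *: rVpoly v.2.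
pose w2 := b *: rVpoly v.1 + a *: rVpoly v.2.
exists (x1%:P + antideriv w1), (x2%:P + antideriv w2).
have E1 : rVpoly v.1 = leg_proj s (x1%:P + antideriv w1).
  by rewrite [in LHS]e1 linearD/= GE poly_rV_K ?size_leg_sum// -linearD.
have E2 : rVpoly v.2 = leg_proj s (x2%:P + antideriv w2).
  by rewrite [in LHS]e2 linearD/= GE poly_rV_K ?size_leg_sum// -linearD.
by split; congr (_ + antideriv _); rewrite leg_proj2 -E1 -E2.
Qed.


Local Notation C := R[i].

(** The stepsize and lam only enter through their product. *)
Lemma hbvm_test_sol (c : 'I_s -> R) (t0 h : R) (lam y0 : C) (sigma : R -> Rcomplex R) :
  injective c -> (forall i, 0 < c i <= 1) -> 0 < h ->
  let q := real_complex R h * lam in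
  hbvm (@int01_C R) (fun y : C => lam * y) c t0 h y0 sigma <->
  exists u1 u2, test_sol (complex.Re q) (complex.Im q)
     (complex.Re y0) (complex.Im y0) u1 u2 /\
    forall x, sigma (t0 + x * h) = Complex u1.[x] u2.[x].
Proof.
move=> c_inj c_range h0; case: lam => a b.
have -> : real_complex R h * Complex a b = Complex (h * a) (h * b).
  by rewrite /real_complex_def; simpc.
move=> /=; case: y0 => x1 x2 /=.
have key (u1 u2 : {poly R}) (i : 'I_s) :
    (forall x, sigma (t0 + x * h) = Complex u1.[x] u2.[x]) ->
    sigma (t0 + c i * h) = (Complex x1 x2 : Rcomplex R) + h *: int01_C (fun tau =>
      (\sum_(j < s) (2 * j + 1)%:R * legendre_int c i j * (legendre R j).[tau])
        *: (Complex a b * sigma (t0 + tau * h) : Rcomplex R)) <->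
    u1.[c i] = x1 + \sum_(j < s) (2 * j + 1)%:R * legendre_int c i j *
       polyint (legendre R j * ((h * a) *: u1 + (- (h * b)) *: u2)) /\
    u2.[c i] = x2 + \sum_(j < s) (2 * j + 1)%:R * legendre_int c i j *
       polyint (legendre R j * ((h * b) *: u1 + (h * a) *: u2)).
  move=> su; rewrite su /int01_C -!/(int01 _).
  have I1 : int01 (fun tau => complex.Re
      ((\sum_(j < s) (2 * j + 1)%:R * legendre_int c i j * (legendre R j).[tau])
        *: (Complex a b * sigma (t0 + tau * h) : Rcomplex R))) =
      \sum_(j < s) (2 * j + 1)%:R * legendre_int c i j *
       polyint (legendre R j * (a *: u1 + (- b) *: u2)).
    under [RHS]eq_bigr do rewrite -leg_moment_horner.
    rewrite -leg_moment_kernel; last exact: cont01_horner.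
    by apply: eq_int01 => tau _; rewrite su/= hornerD !hornerZ mulNr.
  have I2 : int01 (fun tau => complex.Im
      ((\sum_(j < s) (2 * j + 1)%:R * legendre_int c i j * (legendre R j).[tau])
        *: (Complex a b * sigma (t0 + tau * h) : Rcomplex R))) =
      \sum_(j < s) (2 * j + 1)%:R * legendre_int c i j *
       polyint (legendre R j * (b *: u1 + a *: u2)).
    under [RHS]eq_bigr do rewrite -leg_moment_horner.
    rewrite -leg_moment_kernel; last exact: cont01_horner.
    by apply: eq_int01 => tau _; rewrite su/= hornerD !hornerZ [in RHS]addrC.
  have hP k l : \sum_(j < s) (2 * j + 1)%:R * legendre_int c i j *
       polyint (legendre R j * ((h * k) *: u1 + (h * l) *: u2)) =
     h * \sum_(j < s) (2 * j + 1)%:R * legendre_int c i j *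
       polyint (legendre R j * (k *: u1 + l *: u2)).
    rewrite mulr_sumr; apply: eq_bigr => j _.
    by rewrite -!scalerA -scalerDr -scalerAr linearZ/= mulrCA.
  rewrite I1 I2 -mulrN !hP; split=> [[-> ->]//|[-> ->]//].
split=> [[spf s0 sc]|[u1 [u2 [[e1 e2] su]]]].
  have [u1 z1 e1] := poly_fun_le_horner t0 h (@Re_is_scalar R) spf.
  have [u2 z2 e2] := poly_fun_le_horner t0 h (@Im_is_scalar R) spf.
  have su x : sigma (t0 + x * h) = Complex u1.[x] u2.[x].
    by rewrite -e1 -e2; case: (sigma _).
  exists u1, u2; split=> //.
  have := su 0; rewrite mul0r addr0 s0 => -[u10 u20].
  split.
    apply/(collocation _ c_inj c_range z1 (esym u10)) => i.
    by have [] := (key u1 u2 i su).1 (sc i).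
  apply/(collocation _ c_inj c_range z2 (esym u20)) => i.
  by have [] := (key u1 u2 i su).1 (sc i).
have size_sol x w : (size (x%:P + antideriv (leg_proj s w))%R <= s.+1)%N.
  rewrite (leq_trans (size_polyD _ _))// geq_max (leq_trans (size_polyC_leq1 _))//=.
  by rewrite (leq_trans (size_antideriv _))// ltnS size_leg_sum.
have z1 : (size u1 <= s.+1)%N by rewrite e1 size_sol.
have z2 : (size u2 <= s.+1)%N by rewrite e2 size_sol.
have u10 : u1.[0] = x1 by rewrite e1 hornerD hornerC antideriv_horner0 addr0.
have u20 : u2.[0] = x2 by rewrite e2 hornerD hornerC antideriv_horner0 addr0.
split.
- have -> : sigma = (fun t => u1.[(t - t0) / h] *: (Complex 1 0 : Rcomplex R) +
                            u2.[(t - t0) / h] *: (Complex 0 1 : Rcomplex R)).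
    apply/funext => t; rewrite -{1}(subrK t0 t) addrC -{1}(divfK (lt0r_neq0 h0) (t - t0)) su.
    by congr Complex; rewrite /= ?(mulr1, mulr0, addr0, add0r).
  by apply: poly_fun_leD; exact: poly_fun_le_affine.
- by have := su 0; rewrite mul0r addr0 u10 u20.
- move=> i; apply/(key u1 u2 i su); split.
    exact: ((collocation _ c_inj c_range z1 u10).2 e1 i).
  exact: ((collocation _ c_inj c_range z2 u20).2 e2 i).
Qed.

Lemma normc_lt1 (z : C) :
  (`|z| < 1) = (complex.Re z ^+ 2 + complex.Im z ^+ 2 < 1).
Proof.
rewrite -(@ltr_pXn2r _ 2%N) ?nnegrE// -add_Re2_Im2 expr1n.
by rewrite -[X in _ < X](rmorph1 (real_complex R)) ltcR.
Qed.

Lemma A_stable (c : 'I_s -> R) : (1 <= s)%N -> injective c ->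
  (forall i, 0 < c i <= 1) -> perfectly_A_stable c.
Proof.
move=> s1 c_inj c_range; apply/seteqP; split=> q /=.
  move=> [z qz]; rewrite normc_lt1 => z1.
  have [|[sigma sol] val] := qz 0 1 q 1 ltr01; first by rewrite rmorph1 mul1r.
  have [u1 [u2 []]] := (hbvm_test_sol 0 q 1 sigma c_inj c_range ltr01).1 sol.
  rewrite rmorph1 mul1r /= => su sigmaE.
  have := val _ sol; rewrite mulr1 -{1}[1]mul1r sigmaE => ez.
  have := test_sol_energy su.
  have := polyint_leg_proj_sqr_ge0 u1; have := polyint_leg_proj_sqr_ge0 u2.
  move: z1; rewrite -ez/= expr0n expr1n addr0 => z1 p2 p1 e.
  by nra.
case: q => a b /= a0.
have [u1 [u2 su]] := test_sol_exists b 1 0 a0.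
exists (Complex u1.[1] u2.[1]); last first.
  rewrite normc_lt1/=.
  have := test_sol_energy su.
  have p1 := polyint_leg_proj_sqr_ge0 u1; have p2 := polyint_leg_proj_sqr_ge0 u2.
  rewrite expr0n expr1n addr0 => e.
  suff : polyint (leg_proj s u1 * leg_proj s u1) + polyint (leg_proj s u2 * leg_proj s u2) != 0.
    by move=> /eqP ne; nra.
  apply/eqP => z0.
  have /polyint_leg_proj_sqr_eq0 z1 : polyint (leg_proj s u1 * leg_proj s u1) = 0 by lra.
  have /polyint_leg_proj_sqr_eq0 z2 : polyint (leg_proj s u2 * leg_proj s u2) = 0 by lra.
  have u11 : u1 = 1.
    by case: su => -> _; rewrite leg_proj2 z1 z2 !scaler0 addr0 antideriv0 addr0 polyC1.
  by move: z1 => /eqP; rewrite u11 leg_proj_id ?size_poly1// oner_eq0.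
move=> t0 h lam y0 h0 hq; set sol := hbvm _ _ _ _ _ _.
have solP sigma : sol sigma <-> exists u1 u2,
    test_sol a b (complex.Re y0) (complex.Im y0) u1 u2 /\
    forall x, sigma (t0 + x * h) = Complex u1.[x] u2.[x].
  have := hbvm_test_sol t0 lam y0 sigma c_inj c_range h0; rewrite /= hq/=; exact.
split.
  have [v1 [v2 sv]] := test_sol_exists b (complex.Re y0) (complex.Im y0) a0.
  exists (fun t => Complex v1.[(t - t0) / h] v2.[(t - t0) / h]); apply/solP.
  exists v1, v2; split=> // x.
  by rewrite addrAC subrr add0r mulfK// lt0r_neq0.
move=> sigma /solP[v1 [v2 [sv sigmaE]]].
rewrite -[X in t0 + X]mul1r sigmaE.
have su' := test_sol_lin (complex.Re y0) (complex.Im y0) su (test_sol_rot su).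
have := test_sol_lin 1 (-1) sv su'.
rewrite !mul1r !mulr1 !mulr0 !oppr0 !mulr0 !addr0 !add0r !mulN1r !subrr.
move=> /(test_sol_uniq a0)[]; rewrite !scale1r !scaleN1r => /eqP.
rewrite subr_eq0 => /eqP -> /eqP; rewrite subr_eq0 => /eqP ->.
rewrite !(hornerD, hornerZ, hornerN); case: (y0) => x1 x2 /=.
by simpc; congr Complex; ring.
Qed.

End AStability.

(** * Functions of several variables *)
Section ColumnVectors.
Context {R : realType}.

Lemma mx_norm_leP m n (x : 'M[R]_(m, n)) (r : R) : 0 <= r ->
  (`|x| <= r) <-> (forall i j, `|x i j| <= r).
Proof.
move=> r0; rewrite /Num.Def.normr/= mx_normrE; split=> [xr i j|xr].
  by apply: le_trans xr; exact: (le_bigmax _ (fun ij => `|x ij.1 ij.2|) (i, j)).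
by apply: bigmax_le => // -[i j] _; exact: xr.
Qed.

Lemma mx_norm_ge_coord m n (x : 'M[R]_(m, n)) i j : `|x i j| <= `|x|.
Proof. by move: i j; apply/mx_norm_leP. Qed.

Lemma cvg_mx (T : Type) (F : set_system T) {FF : Filter F} m n
    (M : T -> 'M[R]_(m, n)) (l : 'M[R]_(m, n)) :
  (forall i j, M x i j @[x --> F] --> l i j) -> M x @[x --> F] --> l.
Proof.
move=> Ml; apply/cvgrPdist_le => /= e e0.
have : \forall x \near F, forall ij : 'I_m * 'I_n, `|l ij.1 ij.2 - M x ij.1 ij.2| <= e.
  apply: filter_forall => -[i j] /=.
  by move/cvgrPdist_le : (Ml i j) => /(_ _ e0).
apply: filterS => x xe; apply/mx_norm_leP; first exact: ltW.
by move=> i j; have := xe (i, j); rewrite !mxE.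
Qed.

(** Compactness of closed balls, transported from row vectors by transposition. *)
Lemma bounded_on_ball n (g : 'cV[R]_n -> R) (z : 'cV[R]_n) (r : R) :
  continuous g -> exists2 M : R, 0 <= M & forall x, `|x - z| <= r -> `|g x| <= M.
Proof.
move=> cg.
have ctr : continuous (fun v : 'rV[R]_n => v^T).
  move=> v; apply: (@cvg_mx _ (nbhs v)) => i j; rewrite mxE.
  under eq_fun do rewrite mxE.
  exact: coord_continuous.
pose A := [set v : 'rV[R]_n | `|v^T - z| <= r].
have cA : compact A.
  apply: bounded_closed_compact.
    exists (`|z| + r); split; first exact: num_real.
    move=> M zM v /= vA; apply/ltW/(le_lt_trans _ zM).
    have -> : `|v| = `|v^T|.
      by apply/eqP; rewrite eq_le; apply/andP; split; apply/mx_norm_leP => // i j;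
        [have := mx_norm_ge_coord v^T j i | have := mx_norm_ge_coord v j i]; rewrite mxE.
    by rewrite -(subrK z v^T) addrC (le_trans (ler_normD _ _))// lerD2l.
  rewrite /A (_ : [set v | _] = (fun v => `|v^T - z|) @^-1` [set x | x <= r])//.
  apply: closed_comp => [v _|]; last exact: closed_le.
  apply: continuous_comp; last exact: norm_continuous.
  by apply: continuousB; [exact: ctr | exact: cst_continuous].
have cgA : compact ((fun v : 'rV[R]_n => g v^T) @` A).
  apply: continuous_compact => //; apply: continuous_subspaceT => v.
  by apply: continuous_comp; [exact: ctr | exact: cg].
have [M [_ MP]] := compact_bounded cgA.
exists (`|M| + 1) => [|x xz]; first by rewrite addr_ge0.
apply: (MP (`|M| + 1)); first by rewrite (le_lt_trans (ler_norm M))// ltrDl.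
by exists x^T; rewrite /A /= trmxK.
Qed.


(** A coordinate of y may be smaller or larger than that of x in coord_MVT, so
    the end points come in either order. *)
Lemma MVT_unordered (f df : R -> R) (a b : R) :
  (forall x : R, is_derive x 1 f (df x)) ->
  exists2 th, 0 <= th <= 1 & f b - f a = df (a + th * (b - a)) * (b - a).
Proof.
move=> dfP.
have cf (x : R) : {for x, continuous f}.
  by apply: differentiable_continuous; apply/derivable1_diffP; have [] := dfP x.
have H (a' b' : R) : a' <= b' ->
    exists2 c, c \in `[a', b']%R & f b' - f a' = df c * (b' - a').
  by move=> ab; apply: MVT_segment => //; exact: continuous_subspaceT.
have [->|ab] := eqVneq a b.
  by exists 0; rewrite ?lexx ?ler01// !subrr mulr0.
have ba0 : b - a != 0 by rewrite subr_eq0 eq_sym.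
have key c : f b - f a = df c * (b - a) -> 0 <= (c - a) / (b - a) <= 1 ->
    exists2 th, 0 <= th <= 1 & f b - f a = df (a + th * (b - a)) * (b - a).
  move=> e th; exists ((c - a) / (b - a)) => //.
  by rewrite divfK// (addrC a) subrK.
have [lab|lba] := leP a b.
  have [c] := H a b lab; rewrite in_itv/= => /andP[ac cb] e.
  apply: (key c e); have ba : 0 < b - a by rewrite lt_neqAle eq_sym ba0 subr_ge0.
  by rewrite divr_ge0 ?(ltW ba) ?subr_ge0//= ler_pdivrMr// mul1r lerB.
have [c] := H b a (ltW lba); rewrite in_itv/= => /andP[bc ca] e.
apply: (key c).
  by rewrite -(opprB (f a)) e -mulrN opprB.
rewrite -(opprB a c) -(opprB a b) invrN mulrNN.
have ba : 0 < a - b by rewrite subr_gt0.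
by rewrite divr_ge0 ?(ltW ba) ?subr_ge0//= ler_pdivrMr// mul1r lerB.
Qed.

End ColumnVectors.

Section Smooth.
Context {R : realType} {n : nat}.
Implicit Types (g : 'cV[R]_n -> R) (x y z v : 'cV[R]_n).

Local Notation e_ i := (delta_mx i 0 : 'cV[R]_n).

Lemma is_derive_line g v x (t : R) : derivable g (t *: v + x) v ->
  is_derive t 1 (fun t : R => g (t *: v + x)) ('D_v g (t *: v + x)).
Proof.
move=> gv.
have E : (fun h : R => h^-1 *:
     (((fun t : R => g (t *: v + x)) \o shift t) (h *: 1) - g (t *: v + x)))
   = (fun h : R => h^-1 *: ((g \o shift (t *: v + x)) (h *: v) - g (t *: v + x))).
  apply/funext => h /=; congr (_ *: (g _ - _)).
  by rewrite -[h%:A]/(h * 1) mulr1 scalerDl addrA.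
by apply: DeriveDef; rewrite /derivable /derive E.
Qed.

(** One goes from y to x along the edges of a box parallel to the axes, changing
    one coordinate at a time; only partial derivatives are involved.  The balls of
    the sup norm are boxes, so the intermediate points stay in every ball that
    contains x and y.  Lipschitz bounds, linearization and the chain rule for
    class_C functions all follow from this one formula. *)
Lemma coord_MVT g : (forall i x, derivable g x (e_ i)) -> forall x y,
  exists2 xi : 'I_n -> 'cV[R]_n,
    forall j z r, `|x - z| <= r -> `|y - z| <= r -> `|xi j - z| <= r &
    g x - g y = \sum_j partial j g (xi j) * (x j 0 - y j 0).
Proof.
move=> dg x y.
(* The vertices of the path from y to x. *)
pose w (k : nat) : 'cV[R]_n := \col_i (if (i < k)%N then x i 0 else y i 0).
have wS (j : 'I_n) : w j.+1 = (x j 0 - y j 0) *: e_ j + w j.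
  apply/colP => i; rewrite !mxE eqxx andbT ltnS leq_eqVlt.
  have [->|ij] := eqVneq i j; first by rewrite eqxx ltnn mulr1 subrK.
  by rewrite (negbTE (ij : (i != j :> nat))) mulr0 add0r.
have step (j : 'I_n) : exists2 th : R, 0 <= th <= 1 &
    g (w j.+1) - g (w j) = partial j g ((th * (x j 0 - y j 0)) *: e_ j + w j) * (x j 0 - y j 0).
  have [th th01] := @MVT_unordered R (fun t : R => g (t *: e_ j + w j))
    (fun t => 'D_(e_ j) g (t *: e_ j + w j)) 0 (x j 0 - y j 0)
    (fun t => is_derive_line (dg j _)).
  rewrite add0r subr0 scale0r add0r -wS => e; by exists th.
have [th th01 thP] : exists2 th : 'I_n -> R, forall j, 0 <= th j <= 1 & forall j : 'I_n,
    g (w j.+1) - g (w j) =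
      partial j g ((th j * (x j 0 - y j 0)) *: e_ j + w j) * (x j 0 - y j 0).
  by exists (fun j => s2val (cid2 (step j))) => j; case: cid2.
exists (fun j => (th j * (x j 0 - y j 0)) *: e_ j + w j).
  move=> j z r xz yz; have r0 : 0 <= r by apply: le_trans xz.
  apply/mx_norm_leP => // i k; rewrite (ord1 k).
  have xi : `|x i 0 - z i 0| <= r by have := (mx_norm_leP _ r0).1 xz i 0; rewrite !mxE.
  have yi : `|y i 0 - z i 0| <= r by have := (mx_norm_leP _ r0).1 yz i 0; rewrite !mxE.
  rewrite !mxE eqxx andbT; have [ij|ij] := eqVneq i j; last first.
    by rewrite mulr0 add0r; case: ifP.
  rewrite -ij ltnn mulr1; move: (th01 i) xi yi.
  by rewrite !ler_norml => /andP[? ?] /andP[? ?] /andP[? ?]; apply/andP; split; nra.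
under eq_bigr do rewrite -thP.
have -> : g x = g (w n) by congr g; apply/colP => i; rewrite mxE ltn_ord.
have -> : g y = g (w 0%N) by congr g; apply/colP => i; rewrite mxE.
by rewrite -(telescope_sumr (fun k => g (w k)))// big_mkord.
Qed.

Lemma continuous_class_C k g : class_C k g -> continuous g.
Proof. by case: k => [|k] []. Qed.

Lemma class_C_derivable k g : class_C k.+1 g -> forall i x, derivable g x (e_ i).
Proof. by move=> [_ dg] i; have [] := dg i. Qed.

Lemma class_C_partial k g i : class_C k.+1 g -> class_C k (partial i g).
Proof. by move=> [_ dg]; have [] := dg i. Qed.

Lemma class_CW k g : class_C k.+1 g -> class_C k g.
Proof.
elim: k g => [|k IH] g; first by case.
by move=> [cg dg]; split=> // i; have [d1 d2] := dg i; split=> //; exact: IH.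
Qed.

Lemma class_C_le k l g : (k <= l)%N -> class_C l g -> class_C k g.
Proof.
move=> /subnK <-; elim: (l - k)%N => // m IH; rewrite addSn => /class_CW; exact: IH.
Qed.

Lemma class_C_cst k (a : R) : class_C k (fun _ : 'cV[R]_n => a).
Proof.
have ca b : continuous (fun _ : 'cV[R]_n => b : R) by exact: cst_continuous.
elim: k a => [|k IH] a; first by split.
split=> // i; split=> [x|]; first exact: derivable_cst.
rewrite (_ : partial i _ = fun=> 0)//; apply/funext => x.
exact: derive_cst.
Qed.

Lemma class_CD k g1 g2 : class_C k g1 -> class_C k g2 ->
  class_C k (fun x => g1 x + g2 x).
Proof.
elim: k g1 g2 => [|k IH] g1 g2 C1 C2.
  by split=> // x; apply: continuousD; [exact: C1.1 | exact: C2.1].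
split; first by move=> x; apply: continuousD; [exact: C1.1 | exact: C2.1].
move=> i; have [d1i p1] := C1.2 i; have [d2i p2] := C2.2 i.
split=> [x|]; first exact: derivableD.
rewrite (_ : partial i _ = fun x => partial i g1 x + partial i g2 x); first exact: IH.
by apply/funext => x; rewrite /partial -deriveD.
Qed.

Lemma class_CM k g1 g2 : class_C k g1 -> class_C k g2 ->
  class_C k (fun x => g1 x * g2 x).
Proof.
elim: k g1 g2 => [|k IH] g1 g2 C1 C2.
  by split=> // x; apply: continuousM; [exact: C1.1 | exact: C2.1].
split; first by move=> x; apply: continuousM; [exact: C1.1 | exact: C2.1].
move=> i; have [d1i p1] := C1.2 i; have [d2i p2] := C2.2 i.
split=> [x|]; first exact: derivableM.
rewrite (_ : partial i _ = fun x => g1 x * partial i g2 x + g2 x * partial i g1 x).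
  by apply: class_CD; apply: IH => //; exact: class_CW.
by apply/funext => x; rewrite /partial -[LHS]/('D_(e_ i) (g1 * g2) x) deriveM.
Qed.

Lemma class_C_sum k (I : finType) (P : pred I) (F : I -> 'cV[R]_n -> R) :
  (forall i, P i -> class_C k (F i)) -> class_C k (fun x => \sum_(i | P i) F i x).
Proof.
move=> cF; rewrite (_ : (fun x => _) = \sum_(i | P i) F i); last first.
  by apply/funext => x; rewrite fct_sumE.
elim/big_ind : _ => //; first exact: class_C_cst.
by move=> f g; exact: class_CD.
Qed.

End Smooth.


Section SmoothEstimates.
Context {R : realType} {n : nat}.
Implicit Types (g : 'cV[R]_n -> R) (x y z v : 'cV[R]_n).

(** Makes constants uniform in an index. *)
Lemma finite_bounds (I : finType) (P : I -> R -> Prop) :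
  (forall i, exists2 M : R, 0 <= M & P i M) ->
  (forall i (M M' : R), P i M -> M <= M' -> P i M') ->
  exists2 M : R, 0 <= M & forall i, P i M.
Proof.
move=> PM Pmono.
pose M i := s2val (cid2 (PM i)).
have M0 i : 0 <= M i by rewrite /M; case: cid2.
have MP i : P i (M i) by rewrite /M; case: cid2.
exists (\sum_i M i) => [|i]; first by apply: sumr_ge0.
by apply: Pmono (MP i) _; rewrite (bigD1 i)//= lerDl sumr_ge0.
Qed.

Lemma sum_norm_le (a b : 'I_n -> R) (A B : R) :
  (forall j, `|a j| <= A) -> (forall j, `|b j| <= B) ->
  `|\sum_j a j * b j| <= n%:R * A * B.
Proof.
move=> aA bB; apply: (le_trans (ler_norm_sum _ _ _)).
apply: (@le_trans _ _ (\sum_(j < n) A * B)).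
  by apply: ler_sum => j _; rewrite normrM ler_pM.
by rewrite sumr_const card_ord -[_ *+ n]mulr_natl mulrA.
Qed.

Lemma cV_normB_le (x y : 'cV[R]_n) j : `|x j 0 - y j 0| <= `|x - y|.
Proof. by have := mx_norm_ge_coord (x - y) j 0; rewrite !mxE. Qed.

Lemma lipschitz_on_ball g z (r : R) : class_C 1 g ->
  exists2 L : R, 0 <= L & forall x y, `|x - z| <= r -> `|y - z| <= r ->
    `|g x - g y| <= L * `|x - y|.
Proof.
move=> Cg; have [||M M0 MP] := @finite_bounds 'I_n
    (fun j M => forall x, `|x - z| <= r -> `|partial j g x| <= M).
- by move=> j; apply: bounded_on_ball; exact: (continuous_class_C (class_C_partial _ Cg)).
- by move=> j M M' MP MM' x xz; apply: le_trans (MP x xz) MM'.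
exists (n%:R * M) => [|x y xz yz]; first by rewrite mulr_ge0.
have [xi xiP ->] := coord_MVT (class_C_derivable Cg) x y.
by apply: sum_norm_le => j; [apply: MP; exact: xiP | exact: cV_normB_le].
Qed.

(** In coord_MVT, the partial derivatives are taken at points at distance at most
    |x - y| from y, and they are Lipschitz. *)
Lemma linearization_error g z (r : R) : class_C 2 g ->
  exists2 L : R, 0 <= L & forall x y, `|x - z| <= r -> `|y - z| <= r ->
    `|g x - g y - \sum_j partial j g y * (x j 0 - y j 0)| <= L * `|x - y| ^+ 2.
Proof.
move=> Cg; have [||L L0 LP] := @finite_bounds 'I_n
    (fun j L => forall x y, `|x - z| <= r -> `|y - z| <= r ->
      `|partial j g x - partial j g y| <= L * `|x - y|).
- by move=> j; apply: lipschitz_on_ball; exact: class_C_partial.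
- move=> j M M' MP MM' x y xz yz; apply: le_trans (MP x y xz yz) _.
  by rewrite ler_wpM2r.
exists (n%:R * L) => [|x y xz yz]; first by rewrite mulr_ge0.
have [xi xiP ->] := coord_MVT (class_C_derivable Cg) x y.
rewrite -sumrB; under eq_bigr do rewrite -mulrBl.
rewrite expr2 !mulrA -(mulrA _ L); apply: sum_norm_le => j; last exact: cV_normB_le.
apply: le_trans (LP _ _ _ _ _) _ => //; first exact: xiP.
by rewrite ler_wpM2l// xiP// subrr normr0.
Qed.

Lemma is_derive_coord (y : R -> 'cV[R]_n) (t : R) v i :
  is_derive t 1 y v -> is_derive t 1 (fun t => y t i 0) (v i 0).
Proof.
move=> [dy Dy]; have /derivable_mxP/(_ i 0) di := dy.
by apply: DeriveDef => //; rewrite -Dy derive_mx// mxE.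
Qed.

Lemma cvg_sum_fun (T : Type) (F : set_system T) {FF : Filter F} (I : finType)
    (f : I -> T -> R) (l : I -> R) :
  (forall i, f i x @[x --> F] --> l i) ->
  (\sum_i f i x) @[x --> F] --> \sum_i l i.
Proof.
move=> fl; rewrite (_ : (fun w : T => _) = \sum_i f i); last first.
  by apply/funext => w; rewrite fct_sumE.
elim/big_ind2 : _ => [|f1 l1 f2 l2 h1 h2|i _]; first exact: cvg_cst.
  exact: cvgD.
exact: fl.
Qed.

(** Chain rule: coord_MVT writes the difference quotient with partial derivatives
    at points that tend to y t. *)
Lemma is_derive_comp_class_C g (y : R -> 'cV[R]_n) (t : R) v :
  class_C 1 g -> is_derive t 1 y v ->
  is_derive t 1 (fun t => g (y t)) (\sum_j partial j g (y t) * v j 0).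
Proof.
move=> Cg dy.
have yc : {for t, continuous y}.
  by apply: differentiable_continuous; apply/derivable1_diffP; case: dy.
pose xi h := s2val (cid2 (coord_MVT (class_C_derivable Cg) (y (h *: 1 + t)) (y t))).
have xiP h j : `|xi h j - y t| <= `|y (h *: 1 + t) - y t|.
  by rewrite /xi; case: cid2 => /= f fP _; apply: fP => //; rewrite subrr normr0.
have xiE h : g (y (h *: 1 + t)) - g (y t) =
    \sum_j partial j g (xi h j) * (y (h *: 1 + t) j 0 - y t j 0).
  by rewrite /xi; case: cid2.
have lim : (fun h : R => h^-1 *: (((fun t => g (y t)) \o shift t) (h *: 1) - g (y t))) @ 0^'
    --> \sum_j partial j g (y t) * v j 0.
  under eq_fun => h.
    rewrite /= xiE scaler_sumr.
    under eq_bigr do rewrite -[_ *: _]/(_ * _) mulrCA.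
    over.
  apply: cvg_sum_fun => j; apply: cvgM.
    have cp : {for y t, continuous (partial j g)}.
      by exact: (continuous_class_C (class_C_partial j Cg)).
    apply: (@cvg_comp _ _ _ (xi^~ j) (partial j g) 0^' (nbhs (y t))) => //.
    apply/cvgrPdist_le => /= e e0.
    have : (fun h : R => y (h *: 1 + t)) @ 0^' --> y t.
      apply: (@cvg_comp _ _ _ (fun h : R => h *: 1 + t) y 0^' (nbhs t)) => //.
      apply/cvgrPdist_le => /= d d0; near=> h.
      rewrite opprD addrCA subrr addr0 normrN -[h *: 1]/(h * 1) mulr1.
      by near: h; exact: dnbhs0_le.
    move/cvgrPdist_le => /(_ _ e0); apply: filterS => h yh.
    by rewrite distrC (le_trans (xiP h j))// distrC.
  have [dj <-] := is_derive_coord j dy.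
  exact: dj.
apply: DeriveDef; first by apply/cvg_ex; eexists; exact: lim.
exact: cvg_lim lim.
Unshelve. all: by end_near. Qed.

End SmoothEstimates.

(** * Taylor polynomials along a solution *)
Section Taylor.
Context {R : realType}.

Lemma is_derive_affine (V : normedModType R) (f : R -> V) (a h c : R) (v : V) :
  is_derive (a + c * h) 1 f v ->
  is_derive c 1 (fun c : R => f (a + c * h)) (h *: v).
Proof.
move=> [/derivable1_diffP df Df].
pose g (c : R) := a + c * h.
have gE : g = horner (a%:P + h *: 'X).
  by apply/funext => x; rewrite hornerD hornerC hornerZ hornerX mulrC.
have [dg Dg] : is_derive c 1 g h.
  rewrite gE; have := is_derive_poly (a%:P + h *: 'X) c.
  by rewrite derivD derivC derivZ derivX add0r hornerZ hornerC mulr1.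
move/derivable1_diffP : dg => dg.
have dfg : differentiable (f \o g) c by exact: differentiable_comp.
apply: DeriveDef; first exact/derivable1_diffP.
rewrite [LHS](deriveE _ dfg) diff_comp//=.
by rewrite -(deriveE _ dg) Dg -Df (deriveE _ df) -[in LHS](mulr1 h) linearZ.
Qed.

Lemma is_derive_within_continuous (f df : R -> R) (a b : R) :
  (forall x : R, a <= x <= b -> is_derive x 1 f (df x)) ->
  {within `[a, b], continuous f}.
Proof.
move=> dfP; apply: derivable_within_continuous => x; rewrite in_itv/= => /dfP[]//.
Qed.

Lemma growth_bound (phi dphi : R -> R) (d C : R) k : 0 <= C -> phi 0 = 0 ->
  (forall t : R, 0 <= t <= d -> is_derive t 1 phi (dphi t)) ->
  (forall t, 0 <= t <= d -> `|dphi t| <= C * t ^+ k) ->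
  forall t, 0 <= t <= d -> `|phi t| <= C * t ^+ k.+1.
Proof.
move=> C0 phi0 dP dC t /andP[t0 td].
have sub (x : R) : 0 <= x <= t -> 0 <= x <= d.
  by move=> /andP[-> xt]; exact: le_trans td.
have [||c] := @MVT_segment R phi dphi 0 t t0.
- by move=> x; rewrite in_itv/= => /andP[x0 xt]; apply/dP/sub; rewrite !ltW.
- by apply: (@is_derive_within_continuous _ dphi) => x /sub; exact: dP.
rewrite in_itv/= => c0t; rewrite phi0 !subr0 => ->.
rewrite normrM (ger0_norm t0) exprSr mulrA ler_wpM2r//.
apply: le_trans (dC _ (sub _ c0t)) _.
by case/andP: c0t => c0 ct; rewrite ler_wpM2l// lerXn2r ?nnegrE.
Qed.

(** Along Y' = f Y, the derivative of g Y is (Dg) Y, where the Lie derivative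
    Dg is one class less smooth than g.  So a Taylor polynomial of g Y is an
    antiderivative of one of (Dg) Y, and the exponent of the remainder grows by
    one, by the mean value theorem. *)
Lemma taylor_along_solution n (f : 'cV[R]_n -> 'cV[R]_n) (Y : R -> 'cV[R]_n) z r d k g :
  (forall t : R, 0 <= t <= d -> is_derive t 1 Y (f (Y t))) ->
  (forall t, 0 <= t <= d -> `|Y t - z| <= r) ->
  (forall i, class_C k (fun x => f x i 0)) -> class_C k g ->
  exists2 p : {poly R}, (size p <= k)%N & exists2 C : R, 0 <= C &
    forall t, 0 <= t <= d -> `|g (Y t) - p.[t]| <= C * t ^+ k.
Proof.
move=> dY Yr; elim: k g => [|k IH] g Cf Cg.
  exists 0; first by rewrite size_poly0.
  have [M M0 MP] := bounded_on_ball z r (continuous_class_C Cg).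
  by exists M => // t td; rewrite horner0 subr0 expr0 mulr1; exact/MP/Yr.
pose Dg x := \sum_j partial j g x * f x j 0.
have CDg : class_C k Dg.
  apply: class_C_sum => j _; apply: class_CM; first exact: class_C_partial.
  exact: class_CW.
have [q sq [C C0 qC]] := IH Dg (fun i => class_CW (Cf i)) CDg.
exists ((g (Y 0))%:P + antideriv q).
  rewrite (leq_trans (size_polyD _ _))// geq_max (leq_trans (size_polyC_leq1 _))//=.
  by rewrite (leq_trans (size_antideriv _)).
exists C => //.
pose p := (g (Y 0))%:P + antideriv q.
apply: (@growth_bound (fun t => g (Y t) - p.[t]) (fun t => Dg (Y t) - q.[t]) d C k C0).
- by rewrite hornerD hornerC antideriv_horner0 addr0 subrr.
- move=> t td.
  have d1 : is_derive t 1 (fun t => g (Y t)) (Dg (Y t)).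
    by apply: is_derive_comp_class_C; [apply: class_C_le Cg | exact: dY].
  have d2 : is_derive t 1 (fun t => p.[t]) q.[t].
    by have := is_derive_poly p t; rewrite derivD derivC add0r deriv_antideriv.
  exact: is_deriveB.
- exact: qC.
Qed.

End Taylor.

(** * Existence of the stage polynomial *)

(** The contraction principle is applied to matrices of Legendre coefficients. *)
HB.instance Definition _ (R : realType) (m n : nat) := Complete.on 'M[R]_(m, n).

Section Existence.
Context {R : realType}.

Lemma horner_bounded (p : {poly R}) :
  exists2 M : R, 0 <= M & forall x, 0 <= x <= 1 -> `|p.[x]| <= M.
Proof.
exists (\sum_(i < size p) `|p`_i|) => [|x /andP[x0 x1]]; first exact: sumr_ge0.
rewrite horner_coef; apply: (le_trans (ler_norm_sum _ _ _)); apply: ler_sum => i _.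
by rewrite normrM ler_piMr// ger0_norm ?exprn_ge0// exprn_ile1.
Qed.

(** Used when T is the identity or the antiderivative. *)
Lemma leg_sum_bound (T : {linear {poly R} -> {poly R}}) s :
  exists2 K : R, 0 <= K & forall (g : 'I_s -> R) (B : R),
    (forall j, `|g j| <= B) -> forall x, 0 <= x <= 1 ->
    `|(T (leg_sum g)).[x]| <= K * B.
Proof.
have [||K K0 KP] := @finite_bounds R 'I_s (fun j K => forall x, 0 <= x <= 1 ->
  `|(2 * j + 1)%:R * (T (legendre R j)).[x]| <= K).
- move=> j; have [M M0 MP] := horner_bounded ((2 * j + 1)%:R *: T (legendre R j)).
  by exists M => // x /MP; rewrite hornerZ.
- by move=> j M M' MP MM' x x01; apply: le_trans (MP x x01) MM'.
exists (s%:R * K) => [|g B gB x x01]; first by rewrite mulr_ge0.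
rewrite /leg_sum linear_sum/= horner_sum.
under eq_bigr do rewrite linearZ/= hornerZ mulrAC.
by apply: sum_norm_le => // j; exact: KP.
Qed.

Lemma leg_moment_bound s : exists2 K : R, 0 <= K & forall (w : R -> R) (B : R),
  cont01 w -> (forall x, 0 <= x <= 1 -> `|w x| <= B) ->
  forall j : 'I_s, `|leg_moment w j| <= K * B.
Proof.
have [||K K0 KP] := @finite_bounds R 'I_s (fun j K => forall x, 0 <= x <= 1 ->
  `|(legendre R j).[x]| <= K).
- by move=> j; exact: horner_bounded.
- by move=> j M M' MP MM' x x01; apply: le_trans (MP x x01) MM'.
exists K => // w B cw wB j; apply: int01_norm.
  by apply: cont01M => //; exact: cont01_horner.
by move=> x x01; rewrite normrM ler_pM// ?KP ?wB.
Qed.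

Lemma continuous_poly_curve n (u : 'I_n -> {poly R}) :
  continuous (fun x => \col_i (u i).[x]).
Proof.
move=> x; apply: cvg_mx => i j; rewrite mxE.
by under eq_fun do rewrite mxE; exact: continuous_horner.
Qed.

Lemma cont01_comp_poly_curve n (g : 'cV[R]_n -> R) (u : 'I_n -> {poly R}) :
  continuous g -> cont01 (fun x => g (\col_i (u i).[x])).
Proof.
move=> cg; apply: continuous_cont01 => x.
by apply: continuous_comp; [exact: continuous_poly_curve | exact: cg].
Qed.

Lemma cV_coord_linear n (i : 'I_n) : linear_for *%R (fun x : 'cV[R]_n => x i 0).
Proof. by move=> a x y; rewrite !mxE. Qed.

Section HbvmVector.
Variables (n s : nat) (f : 'cV[R]_n -> 'cV[R]_n) (c : 'I_s -> R).
Variables (t0 : R) (y0 : 'cV[R]_n).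
Hypothesis cf : forall i, continuous (fun x => f x i 0).
Hypothesis c_inj : injective c.
Hypothesis c_range : forall i, 0 < c i <= 1.

(** The method in integrated form, u = y0 + h times the antiderivative of
    Pi (f u), coordinate by coordinate. *)
Lemma hbvm_vecP (h : R) (sigma : R -> 'cV[R]_n) : 0 < h ->
  hbvm (@int01_cV R n) f c t0 h y0 sigma <->
  exists2 u : 'I_n -> {poly R}, forall x, sigma (t0 + x * h) = \col_i (u i).[x] &
    forall i, u i = (y0 i 0)%:P + h *: antideriv (leg_sum
      (fun j : 'I_s => leg_moment (fun x => f (sigma (t0 + x * h)) i 0) j)).
Proof.
move=> h0.
have key (u : 'I_n -> {poly R}) (k : 'I_s) :
    (forall x, sigma (t0 + x * h) = \col_i (u i).[x]) ->
    sigma (t0 + c k * h) = y0 + h *: int01_cV (fun tau =>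
          (\sum_(j < s) (2 * j + 1)%:R * legendre_int c k j
                        * (legendre R j).[tau])
            *: f (sigma (t0 + tau * h))) <->
    forall i, (u i).[c k] = y0 i 0 + \sum_(j < s) (2 * j + 1)%:R * legendre_int c k j *
       (h * leg_moment (fun x => f (sigma (t0 + x * h)) i 0) j).
  move=> su.
  have IE i : int01 (fun tau => ((\sum_(j < s) (2 * j + 1)%:R * legendre_int c k j
                        * (legendre R j).[tau])
            *: f (sigma (t0 + tau * h))) i 0) = \sum_(j < s) (2 * j + 1)%:R * legendre_int c k j *
       leg_moment (fun x => f (sigma (t0 + x * h)) i 0) j.
    rewrite -leg_moment_kernel.
      by apply: eq_int01 => x _; rewrite mxE.
    rewrite (_ : (fun x => _) = (fun x => f (\col_i (u i).[x]) i 0)); last first.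
      by apply/funext => x; rewrite su.
    exact: (@cont01_comp_poly_curve n (fun x => f x i 0) u (@cf i)).
  have hS i : \sum_(j < s) (2 * j + 1)%:R * legendre_int c k j *
       (h * leg_moment (fun x => f (sigma (t0 + x * h)) i 0) j) =
      h * \sum_(j < s) (2 * j + 1)%:R * legendre_int c k j *
       leg_moment (fun x => f (sigma (t0 + x * h)) i 0) j.
    by rewrite mulr_sumr; apply: eq_bigr => j _; rewrite mulrCA.
  split=> [/colP e i|e].
    by have := e i; rewrite {1}su !mxE -/(int01 _) IE hS.
  by apply/colP => i; rewrite {1}su !mxE -/(int01 _) IE e hS.
have combE i : (y0 i 0)%:P + h *: antideriv (leg_sum
      (fun j : 'I_s => leg_moment (fun x => f (sigma (t0 + x * h)) i 0) j)) =
    (y0 i 0)%:P + antideriv (leg_sum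
      (fun j : 'I_s => h * leg_moment (fun x => f (sigma (t0 + x * h)) i 0) j)).
  congr (_ + _); rewrite -linearZ/=; congr antideriv; rewrite /leg_sum scaler_sumr.
  by apply: eq_bigr => j _; rewrite scalerA mulrCA.
split=> [[spf s0 sc]|[u su ue]].
  have [u su] : exists u : 'I_n -> {poly R}, forall i, (size (u i) <= s.+1)%N /\
      forall x, sigma (t0 + x * h) i 0 = (u i).[x].
    have H i := poly_fun_le_horner t0 h (cV_coord_linear i) spf.
    by exists (fun i => s2val (cid2 (H i))) => i; case: cid2.
  have sE x : sigma (t0 + x * h) = \col_i (u i).[x].
    by apply/colP => i; rewrite mxE (su i).2.
  exists u => // i; rewrite combE.
  have u0 : (u i).[0] = y0 i 0 by rewrite -(su i).2 mul0r addr0 s0.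
  by apply/(collocation _ c_inj c_range (su i).1 u0) => k; exact: ((key u k sE).1 (sc k)).
have u0 i : (u i).[0] = y0 i 0.
  by rewrite ue hornerD hornerC hornerZ antideriv_horner0 mulr0 addr0.
have zu i : (size (u i) <= s.+1)%N.
  rewrite ue (leq_trans (size_polyD _ _))// geq_max (leq_trans (size_polyC_leq1 _))//=.
  rewrite (leq_trans (size_scale_leq _ _))//.
  by rewrite (leq_trans (size_antideriv _))// ltnS size_leg_sum.
split.
- have -> : sigma = (fun t => \sum_i (u i).[(t - t0) / h] *: (delta_mx i 0 : 'cV[R]_n)).
    apply/funext => t; rewrite -{1}(subrK t0 t) addrC -{1}(divfK (lt0r_neq0 h0) (t - t0)) su.
    by rewrite [LHS](matrix_sum_delta); apply: eq_bigr => i _; rewrite big_ord1 mxE.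
  by apply: poly_fun_le_sum => i; exact: poly_fun_le_affine.
- have := su 0; rewrite mul0r addr0 => ->.
  by apply/colP => i; rewrite mxE.
- move=> k; apply/(key u k su) => i.
  have := ue i; rewrite combE => ue'.
  exact: ((collocation _ c_inj c_range (zu i) (u0 i)).2 ue' k).
Qed.

(** The matrix g of the coefficients of f u determines u; for small h the map
    g |-> coefficients of f u is a contraction of a closed ball whose radius bounds
    the coefficients of every f u with u in the ball of radius r around y0. *)
Lemma hbvm_exists (r M L : R) : 0 < r -> 0 <= M -> 0 <= L ->
  (forall i x, `|x - y0| <= r -> `|f x i 0| <= M) ->
  (forall i x y, `|x - y0| <= r -> `|y - y0| <= r ->
    `|f x i 0 - f y i 0| <= L * `|x - y|) ->
  exists2 h0 : R, 0 < h0 & forall h, 0 < h <= h0 -> exists2 sigma,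
    hbvm (@int01_cV R n) f c t0 h y0 sigma &
    forall tau, 0 <= tau <= 1 -> `|sigma (t0 + tau * h) - y0| <= r.
Proof.
move=> r0 M0 L0 fM fL.
have [K1 K10 K1P] := leg_sum_bound antideriv s.
have [K2 K20 K2P] := leg_moment_bound s.
pose B := K2 * M; have B0 : 0 <= B by rewrite mulr_ge0.
(* The first bound keeps u in the ball of radius r, the second one makes the
   Lipschitz constant at most 1/2; adding 1 avoids a division by zero. *)
pose h0 := Num.min (r / (K1 * B + 1)) (2 * (K2 * L * K1) + 1)^-1.
have d1 : 0 < K1 * B + 1 by rewrite ltr_wpDl// mulr_ge0.
have d2 : 0 < 2 * (K2 * L * K1) + 1 by rewrite ltr_wpDl// !mulr_ge0.
exists h0 => [|h /andP[h_gt0]]; first by rewrite lt_min divr_gt0// invr_gt0.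
rewrite le_min => /andP[hr hL].
have {}hr : h * (K1 * B) <= r.
  by rewrite ler_pdivlMr// mulrDr mulr1 in hr; lra.
have {}hL : K2 * (L * (h * K1)) <= 2^-1.
  have : h * (2 * (K2 * L * K1) + 1) <= 1 by rewrite -ler_pdivlMr// div1r.
  by nra.
pose u (g : 'M[R]_(n, s)) i := (y0 i 0)%:P + h *: antideriv (leg_sum (g i)).
pose Y (g : 'M[R]_(n, s)) x := \col_i (u g i).[x].
pose Phi (g : 'M[R]_(n, s)) : 'M[R]_(n, s) :=
  \matrix_(i, j) leg_moment (fun x => f (Y g x) i 0) j.
pose U := [set g : 'M[R]_(n, s) | `|g| <= B].
have cY g i : cont01 (fun x => f (Y g x) i 0).
  exact: (@cont01_comp_poly_curve n (fun x => f x i 0) (u g) (@cf i)).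
have Ydist g g' x : 0 <= x <= 1 -> `|Y g x - Y g' x| <= h * K1 * `|g - g'|.
  move=> x01; apply/mx_norm_leP => [|i k]; first by rewrite !mulr_ge0// ltW.
  rewrite !mxE !hornerD !hornerC !hornerZ opprD addrACA subrr add0r -mulrBr.
  rewrite -hornerN -hornerD -linearB/= normrM gtr0_norm// -mulrA ler_wpM2l ?(ltW h_gt0)//.
  have -> : leg_sum (g i) - leg_sum (g' i) = leg_sum ((g - g') i).
    rewrite /leg_sum -sumrB; apply: eq_bigr => j _.
    by rewrite -scalerBl -mulrBr !mxE.
  by apply: K1P => // j; exact: mx_norm_ge_coord.
have Yball g x : U g -> 0 <= x <= 1 -> `|Y g x - y0| <= r.
  move=> Ug x01; apply: le_trans hr; apply/mx_norm_leP => [|i k].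
    by rewrite !mulr_ge0// ltW.
  rewrite !mxE (ord1 k) hornerD hornerC addrAC subrr add0r hornerZ normrM gtr0_norm//.
  rewrite ler_wpM2l ?(ltW h_gt0)//; apply: K1P => // j.
  by apply: le_trans Ug; exact: mx_norm_ge_coord.
have PhiU g : U g -> U (Phi g).
  move=> Ug; apply/mx_norm_leP => // i j; rewrite mxE; apply: K2P => // x x01.
  by apply: fM; exact: Yball.
pose F := HB.pack_for {fun U >-> U} Phi (isFun.Build _ _ U U Phi PhiU).
have [|||g Ug gE] := @banach_fixed_point R 'M[R]_(n, s) U F.
- have h2 : (0 : R) <= 2^-1 by rewrite invr_ge0.
  exists (NngNum h2); split => /=; first by rewrite invf_lt1// ltr1n.
  move=> [g g'] /= [Ug Ug'].
  apply/mx_norm_leP => [|i j]; first by rewrite mulr_ge0.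
  rewrite !mxE /leg_moment -int01B; try by apply: cont01M => //; exact: cont01_horner.
  under eq_int01 do rewrite -mulrBr.
  apply: (@le_trans _ _ (K2 * (L * (h * K1 * `|g - g'|)))).
    apply: K2P => [|x x01]; first exact: cont01B.
    apply: le_trans (fL _ _ _ _ _) _; try exact: Yball.
    by rewrite ler_wpM2l//; exact: Ydist.
  by rewrite !mulrA ler_wpM2r// -!mulrA.
- rewrite (_ : U = (fun g => `|g|) @^-1` [set x | x <= B])//.
  by apply: closed_comp => [g _|]; [exact: norm_continuous | exact: closed_le].
- by exists 0; rewrite /U /= normr0.
exists (fun t => Y g ((t - t0) / h)); last first.
  by move=> tau tau01; rewrite addrAC subrr add0r mulfK ?lt0r_neq0//; exact: Yball.
have sE x : Y g ((t0 + x * h - t0) / h) = Y g x.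
  by rewrite addrAC subrr add0r mulfK ?lt0r_neq0.
apply/hbvm_vecP => //; exists (u g) => [x|i]; first by rewrite sE.
rewrite /u; congr (_ + _ *: antideriv _).
have gE' j : g i j = leg_moment (fun x => f (Y g x) i 0) j by rewrite {1}gE mxE.
rewrite /leg_sum; apply: eq_bigr => j _; congr (_ * _ *: _).
by rewrite gE'; apply: eq_int01 => x _; rewrite sE.
Qed.

End HbvmVector.

End Existence.

(** * Projection of continuous functions *)
Section FunctionProjection.
Context {R : realType} (s : nat).
Implicit Types (w : R -> R) (q : {poly R}).

(** The projection leg_proj, extended to functions. *)
Definition leg_approx w : {poly R} := leg_sum (fun j : 'I_s => leg_moment w j).

Lemma eq_leg_approx w w' : (forall x, 0 <= x <= 1 -> w x = w' x) -> leg_approx w = leg_approx w'.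
Proof.
move=> ww'; apply: eq_bigr => j _; congr (_ * _ *: _).
by apply: eq_int01 => x /ww' ->.
Qed.

Lemma leg_approx_horner q : (size q <= s)%N -> leg_approx (horner q) = q.
Proof.
move=> sq; rewrite -[RHS](leg_proj_id sq); apply: eq_bigr => j _.
by rewrite leg_moment_horner.
Qed.

Lemma leg_approxB w w' : cont01 w -> cont01 w' ->
  leg_approx (fun x => w x - w' x) = leg_approx w - leg_approx w'.
Proof.
move=> cw cw'; rewrite /leg_approx /leg_sum -sumrB; apply: eq_bigr => j _.
rewrite -scalerBl -mulrBr /leg_moment -int01B; try by apply: cont01M => //; exact: cont01_horner.
by congr (_ * _ *: _); apply: eq_int01 => x _; rewrite mulrBr.
Qed.

Definition leg_approx_norm_le (K : R) := forall w (B : R), cont01 w ->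
  (forall x, 0 <= x <= 1 -> `|w x| <= B) ->
  forall x, 0 <= x <= 1 -> `|(leg_approx w).[x]| <= K * B.

Lemma leg_approx_bound : exists2 K : R, 0 <= K & leg_approx_norm_le K.
Proof.
have [K1 K10 K1P] := @leg_sum_bound R idfun s.
have [K2 K20 K2P] := @leg_moment_bound R s.
exists (K1 * K2) => [|w B cw wB x x01]; first exact: mulr_ge0.
by rewrite -mulrA; apply: K1P => // j; exact: K2P.
Qed.

(** The projection fixes q, so w and w - q have the same defect. *)
Lemma leg_approx_defect w q (K B : R) :
  leg_approx_norm_le K ->
  cont01 w -> (size q <= s)%N -> (forall x, 0 <= x <= 1 -> `|w x - q.[x]| <= B) ->
  forall x, 0 <= x <= 1 -> `|(leg_approx w).[x] - w x| <= (K + 1) * B.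
Proof.
move=> KP cw sq wq x x01.
have cq : cont01 (horner q) by exact: cont01_horner.
have -> : (leg_approx w).[x] - w x =
    (leg_approx (fun x => w x - q.[x])).[x] - (w x - q.[x]).
  by rewrite leg_approxB// leg_approx_horner// hornerD hornerN; ring.
rewrite mulrDl mul1r (le_trans (ler_normB _ _))// lerD//; last exact: wq.
by apply: KP => //; exact: cont01B.
Qed.

(** The projection is self-adjoint and fixes q. *)
Lemma leg_approx_orth w q : cont01 w -> (size q <= s)%N ->
  int01 (fun x => ((leg_approx w).[x] - w x) * q.[x]) = 0.
Proof.
move=> cw sq.
have cq : cont01 (horner q) by exact: cont01_horner.
have cP : cont01 (horner (leg_approx w)) by exact: cont01_horner.
under eq_int01 do rewrite mulrBl.
rewrite int01B; try exact: cont01M.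
apply/eqP; rewrite subr_eq0; apply/eqP.
transitivity (polyint (leg_approx w * q)).
  by rewrite -int01_horner; apply: eq_int01 => x _; rewrite hornerM.
rewrite polyint_leg_sumM.
transitivity (int01 (fun x => (\sum_(j < s) (2 * j + 1)%:R * polyint (legendre R j * q)
    * (legendre R j).[x]) * w x)).
  rewrite leg_moment_kernel//; apply: eq_bigr => j _.
  by rewrite -!mulrA [in LHS](mulrC (leg_moment _ _)).
apply: eq_int01 => x _; rewrite [RHS]mulrC -[in RHS](leg_proj_id sq).
rewrite /leg_proj /leg_sum horner_sum; congr (_ * _).
by apply: eq_bigr => j _; rewrite hornerZ.
Qed.

End FunctionProjection.

(** * Polynomial solutions of the adjoint equation *)
Section VanishingCoefficients.
Context {R : realType}.
Implicit Types p q : {poly R}.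

Definition low_coef0 k p := forall i, (i < k)%N -> p`_i = 0.

Lemma low_coef0_bound k p : low_coef0 k p ->
  exists2 C : R, 0 <= C & forall t, 0 <= t <= 1 -> `|p.[t]| <= C * t ^+ k.
Proof.
move=> pk; exists (\sum_(i < size p) `|p`_i|) => [|t /andP[t0 t1]].
  exact: sumr_ge0.
rewrite horner_coef mulr_suml (le_trans (ler_norm_sum _ _ _))//; apply: ler_sum => i _.
rewrite normrM; have [ik|ki] := ltnP i k; first by rewrite pk// normr0 !mul0r.
rewrite ler_wpM2l// ger0_norm ?exprn_ge0//.
by rewrite -(subnK ki) exprD ler_piMl ?exprn_ge0 ?exprn_ile1.
Qed.

Lemma low_coef0_mul k p q : low_coef0 k p -> low_coef0 k (p * q).
Proof.
move=> pk i ik; rewrite coefM big1// => j _.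
by rewrite pk ?mul0r// (leq_ltn_trans _ ik)// -ltnS.
Qed.

Lemma low_coef0_sum k (I : finType) (F : I -> {poly R}) :
  (forall i, low_coef0 k (F i)) -> low_coef0 k (\sum_i F i).
Proof. by move=> Fk i ik; rewrite coef_sum big1// => j _; exact: Fk. Qed.

Lemma low_coef0_antideriv k p : low_coef0 k p -> low_coef0 k.+1 (antideriv p).
Proof.
move=> pk [|i] ik; rewrite coef_antideriv; first by rewrite invr0 mulr0.
by rewrite pk ?mul0r.
Qed.

(** Picard iterates for the row vector psi with psi' = - psi A and psi 0 the unit
    vector e_a. *)
Fixpoint adjoint_iter n (A : 'I_n -> 'I_n -> {poly R}) (a : 'I_n) (k : nat) (j : 'I_n) :
    {poly R} :=
  if k is k'.+1 then
    ((a == j)%:R)%:P - antideriv (\sum_i adjoint_iter A a k' i * A i j)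
  else ((a == j)%:R)%:P.

Lemma adjoint_iter0 n (A : 'I_n -> 'I_n -> {poly R}) a k j :
  (adjoint_iter A a k j).[0] = (a == j)%:R.
Proof.
case: k => [|k] /=; first by rewrite hornerC.
by rewrite hornerD hornerN hornerC antideriv_horner0 subr0.
Qed.

Lemma adjoint_iterS_deriv n (A : 'I_n -> 'I_n -> {poly R}) a k j :
  (adjoint_iter A a k.+1 j)^`() = - \sum_i adjoint_iter A a k i * A i j.
Proof. by rewrite /= derivB derivC sub0r deriv_antideriv. Qed.

(** Each Picard step integrates once, which gains one power of the variable. *)
Lemma adjoint_iter_diff n (A : 'I_n -> 'I_n -> {poly R}) a k j :
  low_coef0 k.+1 (adjoint_iter A a k.+1 j - adjoint_iter A a k j).
Proof.
elim: k j => [|k IH] j.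
  by move=> -[|//] _; rewrite -horner_coef0 hornerD hornerN !adjoint_iter0 subrr.
rewrite [adjoint_iter A a k.+2 j]/= [adjoint_iter A a k.+1 j]/=.
rewrite opprD opprK addrACA subrr add0r addrC -linearB/= -sumrB.
apply: low_coef0_antideriv; apply: low_coef0_sum => i.
rewrite -mulrBl; apply: low_coef0_mul => l lk.
by have := IH i l lk; rewrite !coefB => /eqP; rewrite subr_eq0 => /eqP ->; rewrite subrr.
Qed.

End VanishingCoefficients.

(** * The local error *)
Lemma size_comp_scale (R : realType) (p : {poly R}) (h : R) :
  (size (p \Po (h *: 'X)) <= size p)%N.
Proof.
have [->|p0] := eqVneq p 0; first by rewrite comp_poly0.
rewrite (leq_trans (size_comp_poly_leq _ _))// -[leqRHS]prednK ?lt0n ?size_poly_eq0//.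
rewrite ltnS -[leqRHS]muln1 leq_mul2l; apply/orP; right.
by rewrite -subn1 leq_subLR (leq_trans (size_scale_leq _ _))// size_polyX.
Qed.

Section LocalError.
Context {R : realType}.
Variables (n s : nat) (f : 'cV[R]_n -> 'cV[R]_n) (Y : R -> 'cV[R]_n) (d : R).

Local Notation f_ i := (fun x : 'cV[R]_n => f x i 0).

Hypothesis Cf : forall i, class_C 2 (f_ i).
Hypothesis d01 : 0 < d <= 1.
Hypothesis dY : forall t : R, 0 <= t <= d -> is_derive t 1 Y (f (Y t)).

Section OneStep.
Variables (h : R) (u : 'I_n -> {poly R}).
Hypothesis hd : 0 < h <= d.

Let S x := \col_i (u i).[x].
Hypothesis uE : forall i,
  u i = (Y 0 i 0)%:P + h *: antideriv (leg_approx s (fun x => f (S x) i 0)).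

Let h0 : 0 < h. Proof. by case/andP: hd. Qed.
Let h1 : h <= 1. Proof. by case/andP: hd => _ /le_trans; apply; case/andP: d01. Qed.

Let scaled x : 0 <= x <= 1 -> 0 <= x * h <= d.
Proof.
move=> /andP[x0 x1]; rewrite mulr_ge0 ?(ltW h0)//=.
by case/andP: hd => _; apply: le_trans; rewrite ler_piMl ?(ltW h0).
Qed.

(** The error has derivative h eta; rho is the defect of the method. *)
Let err i x := (u i).[x] - Y (x * h) i 0.
Let eta i x := (leg_approx s (fun x => f (S x) i 0)).[x] - f (Y (x * h)) i 0.
Let rho i x := (leg_approx s (fun x => f (S x) i 0)).[x] - f (S x) i 0.

Let dYh (x : R) : 0 <= x <= 1 ->
  is_derive x 1 (fun x => Y (x * h)) (h *: f (Y (x * h))).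
Proof.
move=> x01; have := dY (scaled x01); rewrite -{1}(add0r (x * h)) => D.
have := is_derive_affine D; congr (is_derive _ _ _ _).
by apply/funext => z; rewrite add0r.
Qed.

Let cont_along g : class_C 1 g -> cont01 (fun x => g (Y (x * h))).
Proof.
move=> Cg; pose dg x := \sum_j partial j g (Y (x * h)) * (h *: f (Y (x * h))) j 0.
apply: (@is_derive_within_continuous _ _ dg) => x x01.
exact: is_derive_comp_class_C (dYh x01).
Qed.

Let cS i : cont01 (fun x => f (S x) i 0).
Proof. exact: (@cont01_comp_poly_curve R n (f_ i) u (continuous_class_C (Cf i))). Qed.

Let cY i : cont01 (fun x => f (Y (x * h)) i 0).
Proof. exact: (cont_along (class_CW (Cf i))). Qed.

Let d_err i (x : R) : 0 <= x <= 1 -> is_derive x 1 (err i) (h * eta i x).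
Proof.
move=> x01; rewrite /eta mulrBr.
have d1 := is_derive_coord i (dYh x01); rewrite mxE in d1.
have d2 : is_derive x 1 (fun x => (u i).[x]) (h * (leg_approx s (fun x => f (S x) i 0)).[x]).
  have := is_derive_poly (u i) x.
  by rewrite {2}uE derivD derivC add0r derivZ deriv_antideriv hornerZ.
exact: is_deriveB.
Qed.

Let err0 i : err i 0 = 0.
Proof. by rewrite /err uE hornerD hornerC hornerZ antideriv_horner0 mulr0 addr0 mul0r subrr. Qed.

Let c_err i : cont01 (err i).
Proof.
by apply: (is_derive_within_continuous (df := fun x => h * eta i x)) => x; exact: d_err.
Qed.

(** The derivative of the error is h eta, and
    eta = Pi (f S - f Y) + (Pi (f Y) - f Y).  The first term is at most K L times
    the maximal error, which is absorbed because h K L <= 1/2; the second one is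
    O(h^s), since Pi fixes the Taylor polynomials p i. *)
Lemma stage_error (K L C : R) (p : 'I_n -> {poly R}) :
  0 <= K -> 0 <= L -> 0 <= C ->
  leg_approx_norm_le s K ->
  (forall i x, 0 <= x <= 1 -> `|f (S x) i 0 - f (Y (x * h)) i 0| <= L * `|S x - Y (x * h)|) ->
  (forall i, (size (p i) <= s)%N) ->
  (forall i t, 0 <= t <= d -> `|f (Y t) i 0 - (p i).[t]| <= C * t ^+ s) ->
  h * (K * L) <= 2^-1 ->
  forall x, 0 <= x <= 1 ->
    `|S x - Y (x * h)| <= 2 * ((K + 1) * C) * h ^+ s.+1 /\
    forall i, `|eta i x| <= 2 * ((K + 1) * C) * h ^+ s.
Proof.
move=> K0 L0 C0 KP LP sp pC hKL.
pose D := (K + 1) * C * h ^+ s.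
have hs0 : 0 <= h ^+ s by rewrite exprn_ge0 // ltW.
have D0 : 0 <= D by rewrite !mulr_ge0 ?addr_ge0.
have defect i x : 0 <= x <= 1 ->
    `|(leg_approx s (fun x => f (Y (x * h)) i 0)).[x] - f (Y (x * h)) i 0| <= D.
  move=> x01; rewrite /D -mulrA.
  apply: (leg_approx_defect (q := p i \Po (h *: 'X)) KP) => //.
    exact: leq_trans (size_comp_scale _ _) (sp i).
  move=> t t01; rewrite horner_comp hornerZ hornerX [h * t]mulrC.
  apply: le_trans (pC i _ (scaled t01)) _.
  rewrite ler_wpM2l// lerXn2r ?nnegrE ?(ltW h0)//.
    by have /andP[] := scaled t01.
  by case/andP: t01 => _ ?; rewrite ler_piMl// ltW.
have eta_le E : (forall x, 0 <= x <= 1 -> `|S x - Y (x * h)| <= E) ->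
    forall i x, 0 <= x <= 1 -> `|eta i x| <= K * (L * E) + D.
  move=> SE i x x01.
  have -> : eta i x =
      (leg_approx s (fun x => f (S x) i 0 - f (Y (x * h)) i 0)).[x] +
      ((leg_approx s (fun x => f (Y (x * h)) i 0)).[x] - f (Y (x * h)) i 0).
    by rewrite leg_approxB// hornerD hornerN /eta addrA subrK.
  rewrite (le_trans (ler_normD _ _))// lerD//; last exact: defect.
  apply: KP => // [|t t01]; first exact: cont01B.
  by apply: le_trans (LP i t t01) _; rewrite ler_wpM2l// SE.
have err_le E : (forall x, 0 <= x <= 1 -> `|S x - Y (x * h)| <= E) ->
    forall x, 0 <= x <= 1 -> `|S x - Y (x * h)| <= h * (K * (L * E) + D).
  move=> SE x x01.
  have E0 : 0 <= E by apply: le_trans (SE x x01).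
  have B0 : 0 <= h * (K * (L * E) + D).
    by apply: mulr_ge0; [exact: ltW | apply: addr_ge0 => //; do 2 apply: mulr_ge0 => //].
  apply/mx_norm_leP => // i k; rewrite (ord1 k) !mxE.
  have := @growth_bound R (err i) (fun x => h * eta i x) 1 _ 0 B0 (err0 i) (d_err i) _ x x01.
  move=> /(_ _)/le_trans; apply.
    by move=> t t01; rewrite expr0 mulr1 normrM gtr0_norm// ler_wpM2l ?(ltW h0)// eta_le.
  by rewrite expr1 ler_piMr//; case/andP: x01.
(* The maximal error E satisfies E <= h K L E + h D <= E / 2 + h D. *)
have [xm xm01 xmax] : exists2 xm, 0 <= xm <= 1 &
    forall x, 0 <= x <= 1 -> `|S x - Y (x * h)| <= `|S xm - Y (xm * h)|.
  have [|xm] := @EVT_max R (fun x => `|S x - Y (x * h)|) 0 1 ler01.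
    have cYh : {within `[0, 1], continuous (fun x => Y (x * h))}.
      by apply: derivable_within_continuous => x; rewrite in_itv/= => /dYh[].
    have cSh : {within `[0, 1], continuous S}.
      by apply: continuous_subspaceT; exact: continuous_poly_curve.
    move=> x; apply: cvg_norm.
    by apply: cvgB; [exact: cSh | exact: cYh].
  by rewrite in_itv/= => xm01 xmax; exists xm => // x x01; apply: xmax; rewrite in_itv.
pose E := `|S xm - Y (xm * h)|.
have E_le : E <= 2 * (h * D).
  have := err_le E xmax xm xm01; rewrite -/E.
  have := ler_wpM2r (normr_ge0 (S xm - Y (xm * h))) hKL; rewrite -/E.
  by rewrite [h * (_ + _)]mulrDr !mulrA; lra.
move=> x x01; split.
  apply: le_trans (xmax x x01) _; apply: le_trans E_le _.
  by rewrite /D exprS; lra.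
move=> i; apply: le_trans (eta_le E xmax i x x01) _.
suff : K * (L * E) <= D by rewrite /D; lra.
have := ler_wpM2l (mulr_ge0 K0 L0) E_le; have := ler_wpM2r D0 hKL.
have -> : K * L * (2 * (h * D)) = 2 * (h * (K * L) * D) by ring.
by move=> A B; rewrite [K * (L * E)]mulrA; lra.
Qed.


(** The derivative of the sum of psi_i (x h) err_i x is h psi (x h) rho x up to
    O(h^(2s+2)): the linear part of f S - f Y is cancelled by the approximate
    adjoint equation for psi.  The defect rho is O(h^s) and orthogonal to the
    polynomials of degree less than s, hence to the low order part of psi, and
    the remaining part of psi (x h) is O(h^s). *)
Lemma superconvergence (psi : 'I_n -> {poly R}) (Ce L2 B P Q : R) :
  0 <= Ce -> 0 <= L2 -> 0 <= B -> 0 <= P -> 0 <= Q ->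
  (forall x, 0 <= x <= 1 -> `|S x - Y (x * h)| <= Ce * h ^+ s.+1) ->
  (forall i x, 0 <= x <= 1 -> `|rho i x| <= Ce * h ^+ s) ->
  (forall i x, 0 <= x <= 1 ->
    `|f (S x) i 0 - f (Y (x * h)) i 0 -
      \sum_j partial j (f_ i) (Y (x * h)) * (S x j 0 - Y (x * h) j 0)|
      <= L2 * `|S x - Y (x * h)| ^+ 2) ->
  (forall i t, 0 <= t <= 1 -> `|(psi i).[t]| <= P) ->
  (forall i t, 0 <= t <= 1 -> `|(psi i - take_poly s (psi i)).[t]| <= Q * t ^+ s) ->
  (forall t, 0 <= t <= d -> forall j,
    `|\sum_i (psi i).[t] * partial j (f_ i) (Y t) + (psi j)^`().[t]| <= B * t ^+ s) ->
  `|\sum_i (psi i).[h] * err i 1| <=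
     (n%:R * Q * Ce + (n%:R * P * (L2 * Ce ^+ 2) + n%:R * B * Ce)) * h ^+ (2 * s).+1.
Proof.
move=> Ce0 L20 B0 P0 Q0 SY rhoC fQ psiP psiQ adj.
have hs0 k : 0 <= h ^+ k by rewrite exprn_ge0 // ltW.
have hxs x k : 0 <= x <= 1 -> (x * h) ^+ k <= h ^+ k.
  move=> x01; have /andP[xh0 _] := scaled x01.
  by rewrite lerXn2r ?nnegrE ?(ltW h0)//; case/andP: x01 => _ ?; rewrite ler_piMl// ltW.
have xh1 x : 0 <= x <= 1 -> 0 <= x * h <= 1.
  move=> /scaled/andP[-> xd]; apply: le_trans xd _; by case/andP: d01.
have SYi x i : 0 <= x <= 1 -> `|err i x| <= Ce * h ^+ s.+1.
  move=> x01; apply: le_trans (SY x x01).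
  by have := cV_normB_le (S x) (Y (x * h)) i; rewrite mxE.
(* Rm is the remainder of the linearization of f at the exact solution. *)
pose Rm i x := f (S x) i 0 - f (Y (x * h)) i 0 -
      \sum_j partial j (f_ i) (Y (x * h)) * err j x.
have RmC i x : 0 <= x <= 1 -> `|Rm i x| <= L2 * (Ce * h ^+ s.+1) ^+ 2.
  move=> x01; have := fQ i x x01; under eq_bigr do rewrite mxE -/(err _ _).
  move/le_trans; apply; rewrite ler_wpM2l// lerXn2r ?nnegrE//; last exact: SY.
  by rewrite mulr_ge0.
pose G x := \sum_i (psi i).[x * h] * err i x.
pose main x := \sum_i (psi i).[x * h] * rho i x.
pose rem x := \sum_i (psi i).[x * h] * Rm i x +
  \sum_j (\sum_i (psi i).[x * h] * partial j (f_ i) (Y (x * h)) + (psi j)^`().[x * h]) * err j x.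
have dpsi i (x : R) : is_derive x 1 (fun x => (psi i).[x * h]) (h *: (psi i)^`().[x * h]).
  have D : is_derive (0 + x * h) 1 (horner (psi i)) (psi i)^`().[x * h].
    by rewrite add0r; exact: is_derive_poly.
  have := is_derive_affine D; congr (is_derive _ _ _ _).
  by apply/funext => z; rewrite add0r.
have etaE i x : eta i x = rho i x + (Rm i x +
    \sum_j partial j (f_ i) (Y (x * h)) * err j x).
  by rewrite /Rm subrK /eta /rho addrA subrK.
have dG (x : R) : 0 <= x <= 1 -> is_derive x 1 G (h * (main x + rem x)).
  move=> x01.
  have -> : h * (main x + rem x) =
     \sum_i ((psi i).[x * h] *: (h * eta i x) + err i x *: (h *: (psi i)^`().[x * h])).
    transitivity (\sum_i h * ((psi i).[x * h] * rho i x + ((psi i).[x * h] * Rm i x +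
        (\sum_j (psi i).[x * h] * partial j (f_ i) (Y (x * h)) * err j x +
        (psi i)^`().[x * h] * err i x)))); last first.
      apply: eq_bigr => i _; rewrite /GRing.scale/= etaE.
      under eq_bigr do rewrite -mulrA.
      by rewrite -mulr_sumr; ring.
    rewrite -mulr_sumr !big_split/= exchange_big/= -big_split/=.
    rewrite /main /rem; congr (_ * (_ + (_ + _))); apply: eq_bigr => j _.
    by rewrite mulrDl mulr_suml.
  rewrite (_ : G = \sum_i (fun x => (psi i).[x * h]) * err i); last first.
    by apply/funext => z; rewrite fct_sumE.
  apply: is_derive_sum => i.
  exact: is_deriveM (dpsi i x) (d_err i x01).
have cscaled (p : {poly R}) : cont01 (fun x => p.[x * h]).
  rewrite (_ : (fun x => _) = horner (p \Po (h *: 'X))); first exact: cont01_horner.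
  by apply/funext => x; rewrite horner_comp hornerZ hornerX mulrC.
have cpsi i := cscaled (psi i); have cdpsi i := cscaled (psi i)^`().
have crho i : cont01 (rho i) by apply: cont01B => //; exact: cont01_horner.
have cpart i j : cont01 (fun x => partial j (f_ i) (Y (x * h))).
  exact: (cont_along (class_C_partial j (Cf i))).
have cRm i : cont01 (Rm i).
  by apply: cont01B; [exact: cont01B | apply: cont01_sum => j _; exact: cont01M].
have cmain : cont01 main by apply: cont01_sum => i _; exact: cont01M.
have crem : cont01 rem.
  apply: cont01D; first by apply: cont01_sum => i _; exact: cont01M.
  apply: cont01_sum => j _; apply: cont01M => //; apply: cont01D => //.
  by apply: cont01_sum => i _; exact: cont01M.
have cG : cont01 G by apply: cont01_sum => i _; exact: cont01M.
have -> : \sum_i (psi i).[h] * err i 1 = h * (int01 main + int01 rem).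
  rewrite -int01D// -int01Z; last exact: cont01D.
  transitivity (G 1 - G 0).
    rewrite /G [X in _ - X]big1 ?subr0 => [|i _]; last by rewrite err0 mulr0.
    by under [RHS]eq_bigr do rewrite mul1r.
  apply/esym/int01_FTC => //.
    by apply: cont01M; [exact: cont01_cst | exact: cont01D].
  by move=> x /andP[x0 x1]; apply: dG; rewrite !ltW.
have main_le : `|int01 main| <= n%:R * Q * Ce * h ^+ (2 * s).
  have mainE i : int01 (fun x => (psi i).[x * h] * rho i x) =
      int01 (fun x => (psi i - take_poly s (psi i)).[x * h] * rho i x).
    (* The low order part of psi i, in the stage variable. *)
    pose q := take_poly s (psi i) \Po (h *: 'X).
    have sq : (size q <= s)%N.
      by apply: leq_trans (size_comp_scale _ _) _; exact: size_take_poly.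
    have qE x : q.[x] = (take_poly s (psi i)).[x * h].
      by rewrite horner_comp hornerZ hornerX mulrC.
    transitivity (int01 (fun x => (psi i).[x * h] * rho i x) - int01 (fun x => rho i x * q.[x])).
      by rewrite leg_approx_orth ?subr0.
    have cq : cont01 (horner q) by exact: cont01_horner.
    rewrite -int01B; try exact: cont01M.
    by apply: eq_int01 => x _; rewrite qE hornerD hornerN; ring.
  rewrite /main int01_sum => [|i _]; last exact: cont01M.
  under eq_bigr do rewrite mainE.
  apply: (le_trans (ler_norm_sum _ _ _)).
  apply: (@le_trans _ _ (\sum_(i < n) (Q * h ^+ s) * (Ce * h ^+ s))).
    apply: ler_sum => i _; apply: int01_norm => [|x x01].
      exact: cont01M (cscaled _) (crho i).
    rewrite normrM ler_pM ?rhoC//.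
    by apply: le_trans (psiQ i _ (xh1 x x01)) _; rewrite ler_wpM2l// hxs.
  rewrite sumr_const card_ord -[_ *+ n]mulr_natl mul2n -addnn exprD.
  by rewrite le_eqVlt; apply/orP; left; apply/eqP; ring.
have rem_le : `|int01 rem| <= (n%:R * P * (L2 * Ce ^+ 2) + n%:R * B * Ce) * h ^+ (2 * s).
  apply: int01_norm => // x x01; rewrite /rem.
  apply: (le_trans (ler_normD _ _)).
  apply: (@le_trans _ _ (n%:R * P * (L2 * (Ce * h ^+ s.+1) ^+ 2) +
     n%:R * (B * h ^+ s) * (Ce * h ^+ s.+1))).
    apply: lerD.
      by apply: sum_norm_le => i; [exact/psiP/xh1 | exact: RmC].
    apply: sum_norm_le => j; last exact: SYi.
    by apply: le_trans (adj _ (scaled x01) j) _; rewrite ler_wpM2l// hxs.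
  have h2s : h ^+ (2 * s) = h ^+ s * h ^+ s by rewrite mul2n -addnn exprD.
  rewrite mulrDl h2s (exprS h s); move: (h ^+ s) (hs0 s) => w w0.
  apply: lerD.
    have -> : n%:R * P * (L2 * (Ce * (h * w)) ^+ 2) =
       n%:R * P * (L2 * Ce ^+ 2) * (w * w) * h ^+ 2 by ring.
    by rewrite ler_piMr ?mulr_ge0 ?sqr_ge0// exprn_ile1// ltW.
  have -> : n%:R * (B * w) * (Ce * (h * w)) = n%:R * B * Ce * (w * w) * h by ring.
  by rewrite ler_piMr ?mulr_ge0.
rewrite normrM gtr0_norm// (exprS h) mulrCA ler_wpM2l ?(ltW h0)//.
by rewrite mulrDl; apply: le_trans (ler_normD _ _) _; exact: lerD.
Qed.

End OneStep.

(** The difference of the last two Picard iterates is O(t^s), and so is the error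
    made by replacing the partial derivatives along Y by polynomials. *)
Lemma adjoint_row (p : 'I_n -> 'I_n -> {poly R}) (C r : R) (a : 'I_n) :
  (0 < s)%N -> 0 <= C ->
  (forall i j t, 0 <= t <= d -> `|partial j (f_ i) (Y t) - (p i j).[t]| <= C * t ^+ s) ->
  (forall t, 0 <= t <= d -> `|Y t - Y 0| <= r) ->
  exists2 psi : 'I_n -> {poly R}, forall j, (psi j).[0] = (a == j)%:R &
  exists2 B : R, 0 <= B & forall t, 0 <= t <= d -> forall j,
    `|\sum_i (psi i).[t] * partial j (f_ i) (Y t) + (psi j)^`().[t]| <= B * t ^+ s.
Proof.
move=> s_gt0 C0 pC Yr; exists (adjoint_iter p a s); first by move=> j; exact: adjoint_iter0.
case: s s_gt0 pC => // k _ pC.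
have [||D D0 DP] := @finite_bounds R 'I_n (fun i D => forall t, 0 <= t <= 1 ->
    `|(adjoint_iter p a k.+1 i - adjoint_iter p a k i).[t]| <= D * t ^+ k.+1).
- by move=> i; apply: low_coef0_bound; exact: adjoint_iter_diff.
- move=> i M M' MP MM' t t01; apply: le_trans (MP t t01) _.
  by rewrite ler_wpM2r// exprn_ge0//; case/andP: t01.
have [||P P0 PP] := @finite_bounds R 'I_n (fun i P => forall t, 0 <= t <= 1 ->
    `|(adjoint_iter p a k i).[t]| <= P).
- by move=> i; exact: horner_bounded.
- by move=> i M M' MP MM' t t01; apply: le_trans (MP t t01) MM'.
have [||A A0 AP] := @finite_bounds R ('I_n * 'I_n)%type (fun ij A => forall x,
    `|x - Y 0| <= r -> `|partial ij.2 (f_ ij.1) x| <= A).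
- move=> [i j]; apply: bounded_on_ball => /=.
  exact: (continuous_class_C (class_C_partial j (Cf i))).
- by move=> i M M' MP MM' x xr; apply: le_trans (MP x xr) MM'.
exists (n%:R * D * A + n%:R * P * C) => [|t td j].
  by rewrite addr_ge0 ?mulr_ge0.
have t01 : 0 <= t <= 1.
  by case/andP: td => -> /le_trans; apply; case/andP: d01.
have t0 : 0 <= t ^+ k.+1 by rewrite exprn_ge0//; case/andP: t01.
rewrite adjoint_iterS_deriv hornerN horner_sum.
have -> : \sum_i (adjoint_iter p a k.+1 i).[t] * partial j (f_ i) (Y t) -
      \sum_i (adjoint_iter p a k i * p i j).[t] =
    \sum_i (adjoint_iter p a k.+1 i - adjoint_iter p a k i).[t] * partial j (f_ i) (Y t) +
    \sum_i (adjoint_iter p a k i).[t] * (partial j (f_ i) (Y t) - (p i j).[t]).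
  rewrite -sumrB -big_split/=; apply: eq_bigr => i _.
  by rewrite hornerM hornerD hornerN; ring.
apply: (le_trans (ler_normD _ _)); rewrite mulrDl; apply: lerD.
  rewrite -[leRHS]mulrA [A * _]mulrC mulrA -[n%:R * D * _]mulrA.
  by apply: sum_norm_le => i; [exact: DP | exact: (AP (i, j) _ (Yr t td))].
by rewrite -[leRHS]mulrA; apply: sum_norm_le => i; [exact: PP | exact: pC].
Qed.

End LocalError.

Section LocalErrorTheorem.
Context {R : realType}.

Lemma taylor_polys (I : finType) n (f : 'cV[R]_n -> 'cV[R]_n) (Y : R -> 'cV[R]_n) z r d k
    (g : I -> 'cV[R]_n -> R) :
  (forall t : R, 0 <= t <= d -> is_derive t 1 Y (f (Y t))) ->
  (forall t, 0 <= t <= d -> `|Y t - z| <= r) ->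
  (forall i, class_C k (fun x => f x i 0)) -> (forall i, class_C k (g i)) ->
  exists2 p : I -> {poly R}, forall i, (size (p i) <= k)%N & exists2 C : R, 0 <= C &
    forall i t, 0 <= t <= d -> `|g i (Y t) - (p i).[t]| <= C * t ^+ k.
Proof.
move=> dY Yr Cf Cg.
pose T i := cid2 (taylor_along_solution dY Yr Cf (Cg i)).
exists (fun i => s2val (T i)) => [i|]; first exact: (s2valP (T i)).
apply: (@finite_bounds R I (fun i C => forall t, 0 <= t <= d ->
  `|g i (Y t) - (s2val (T i)).[t]| <= C * t ^+ k)) => i.
  exact: (s2valP' (T i)).
move=> M M' MP MM' t td; apply: le_trans (MP t td) _.
by rewrite ler_wpM2r// exprn_ge0//; case/andP: td.
Qed.

(** By superconvergence, psi_k h * e 1 = O(h^(2s+1)) for each k, where psi_k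
    starts from the k-th unit vector.  As psi_k h is within O(h) of that vector, the
    k-th coordinate of e 1 is O(h^(2s+1)) + O(h) |e 1|. *)
Theorem local_error n s (f : 'cV[R]_n -> 'cV[R]_n) (Y : R -> 'cV[R]_n) (d r : R) :
  (0 < s)%N -> (forall i, class_C (2 * s) (fun x => f x i 0)) -> 0 < d <= 1 ->
  (forall t : R, 0 <= t <= d -> is_derive t 1 Y (f (Y t))) ->
  (forall t, 0 <= t <= d -> `|Y t - Y 0| <= r) ->
  exists h1 C : R, 0 < h1 <= d /\ forall h, 0 < h <= h1 ->
    forall u : 'I_n -> {poly R},
    (forall i, u i = (Y 0 i 0)%:P +
       h *: antideriv (leg_approx s (fun x => f (\col_i (u i).[x]) i 0))) ->
    (forall x, 0 <= x <= 1 -> `|\col_i (u i).[x] - Y 0| <= r) ->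
    `|\col_i (u i).[1] - Y h| <= C * h ^+ (2 * s).+1.
Proof.
move=> s_gt0 Cf d01 dY Yr.
have Cf2 i : class_C 2 (fun x => f x i 0).
  by apply: class_C_le (Cf i); rewrite leq_pmulr.
have Cfs i : class_C s (fun x => f x i 0).
  by apply: class_C_le (Cf i); rewrite leq_pmull.
have Cpf (ij : 'I_n * 'I_n) : class_C s (partial ij.2 (fun x => f x ij.1 0)).
  apply: class_C_partial; apply: class_C_le (Cf _).
  by rewrite mul2n -addnn -addn1 leq_add2l.
have [p sp [C1 C10 pC]] := taylor_polys dY Yr Cfs Cfs.
have [a _ [C2 C20 aC]] := taylor_polys dY Yr Cfs Cpf.
have [K K0 KP] := @leg_approx_bound R s.
have [||L L0 LP] := @finite_bounds R 'I_n (fun i L => forall x y,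
   `|x - Y 0| <= r -> `|y - Y 0| <= r -> `|f x i 0 - f y i 0| <= L * `|x - y|).
- by move=> i; apply: lipschitz_on_ball; exact: class_CW.
- move=> i M M' MP MM' x y xr yr; apply: le_trans (MP x y xr yr) _.
  by rewrite ler_wpM2r.
have [||L2 L20 L2P] := @finite_bounds R 'I_n (fun i L => forall x y,
   `|x - Y 0| <= r -> `|y - Y 0| <= r -> `|f x i 0 - f y i 0 -
     \sum_j partial j (fun x => f x i 0) y * (x j 0 - y j 0)| <= L * `|x - y| ^+ 2).
- by move=> i; exact: linearization_error.
- move=> i M M' MP MM' x y xr yr; apply: le_trans (MP x y xr yr) _.
  by rewrite ler_wpM2r// exprn_ge0.
pose T k := cid2 (adjoint_row Cf2 d01 k s_gt0 C20 (fun i j => aC (i, j)) Yr).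
pose psi k := s2val (T k).
have psi0 k j : (psi k j).[0] = (k == j)%:R by exact: (s2valP (T k)).
have [||B B0 BP] := @finite_bounds R 'I_n (fun k B => forall t, 0 <= t <= d -> forall j,
    `|\sum_i (psi k i).[t] * partial j (fun x => f x i 0) (Y t) + (psi k j)^`().[t]|
      <= B * t ^+ s).
- by move=> k; exact: (s2valP' (T k)).
- move=> i M M' MP MM' t td j; apply: le_trans (MP t td j) _.
  by rewrite ler_wpM2r// exprn_ge0//; case/andP: td.
have [||P P0 PP] := @finite_bounds R ('I_n * 'I_n)%type (fun ki P => forall t, 0 <= t <= 1 ->
    `|(psi ki.1 ki.2).[t]| <= P).
- by move=> ki; exact: horner_bounded.
- by move=> i M M' MP MM' t t01; apply: le_trans (MP t t01) MM'.
have [||Q Q0 QP] := @finite_bounds R ('I_n * 'I_n)%type (fun ki Q => forall t, 0 <= t <= 1 ->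
    `|(psi ki.1 ki.2 - take_poly s (psi ki.1 ki.2)).[t]| <= Q * t ^+ s).
- move=> ki; apply: low_coef0_bound => i si.
  by rewrite coefB coef_take_poly si subrr.
- move=> i M M' MP MM' t t01; apply: le_trans (MP t t01) _.
  by rewrite ler_wpM2r// exprn_ge0//; case/andP: t01.
have [||N N0 NP] := @finite_bounds R ('I_n * 'I_n)%type (fun ki N => forall t, 0 <= t <= 1 ->
    `|(psi ki.1 ki.2 - ((ki.1 == ki.2)%:R)%:P).[t]| <= N * t ^+ 1).
- move=> ki; apply: low_coef0_bound => -[|//] _.
  by rewrite -horner_coef0 hornerD hornerN hornerC psi0 subrr.
- move=> i M M' MP MM' t t01; apply: le_trans (MP t t01) _.
  by rewrite ler_wpM2r// exprn_ge0//; case/andP: t01.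
(* D is the constant of stage_error; the factor 1 + L makes Ce bound the defect
   rho as well. *)
pose D := 2 * ((K + 1) * C1); pose Ce := D * (1 + L).
have D0 : 0 <= D by rewrite !mulr_ge0 ?addr_ge0.
have Ce0 : 0 <= Ce by rewrite mulr_ge0 ?addr_ge0.
pose C6 := n%:R * Q * Ce + (n%:R * P * (L2 * Ce ^+ 2) + n%:R * B * Ce).
have d1 : 0 < 2 * (K * L) + 1 by rewrite ltr_wpDl// !mulr_ge0.
have d2 : 0 < 2 * (n%:R * N) + 1 by rewrite ltr_wpDl// !mulr_ge0.
case/andP: (d01) => d_gt0 d_le1.
exists (Num.min d (Num.min (2 * (K * L) + 1)^-1 (2 * (n%:R * N) + 1)^-1)), (2 * C6).
split=> [|h /andP[h0]].
  by rewrite !lt_min d_gt0 !invr_gt0 d1 d2/= ge_min lexx.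
rewrite !le_min => /and3P[hd hKL hN] u uE Sr.
have {}hKL : h * (K * L) <= 2^-1.
  by move: hKL; rewrite -[_^-1]div1r ler_pdivlMr// => ?; lra.
have {}hN : n%:R * (N * h) <= 2^-1.
  by move: hN; rewrite -[_^-1]div1r ler_pdivlMr// => ?; lra.
have h0d : 0 < h <= d by rewrite h0.
have h_le1 : h <= 1 by exact: le_trans hd d_le1.
have hYr x : 0 <= x <= 1 -> `|Y (x * h) - Y 0| <= r.
  move=> /andP[x0 x1]; apply: (Yr); rewrite mulr_ge0 ?(ltW h0)//=.
  by apply: le_trans hd; rewrite ler_piMl// ltW.
have st := stage_error Cf2 dY h0d uE K0 L0 C10 KP
  (fun i x x01 => LP i _ _ (Sr x x01) (hYr x x01)) sp pC hKL.
have hs k : 0 <= h ^+ k by rewrite exprn_ge0// ltW.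
have SY x : 0 <= x <= 1 -> `|\col_i (u i).[x] - Y (x * h)| <= D * h ^+ s.+1.
  by move=> /st[].
have Ce1 x : 0 <= x <= 1 -> `|\col_i (u i).[x] - Y (x * h)| <= Ce * h ^+ s.+1.
  move=> /SY/le_trans; apply; rewrite ler_wpM2r// /Ce.
  by rewrite mulrDr mulr1 lerDl mulr_ge0.
have rhoC i x : 0 <= x <= 1 ->
    `|(leg_approx s (fun x => f (\col_i (u i).[x]) i 0)).[x] - f (\col_i (u i).[x]) i 0|
      <= Ce * h ^+ s.
  move=> x01; have [_ etaC] := st x x01.
  have := LP i _ _ (Sr x x01) (hYr x x01); have := etaC i; have := SY x x01.
  move=> e_le F_le y_le.
  apply: (le_trans (ler_distD (f (Y (x * h)) i 0) _ _)).
  rewrite [X in _ + X]distrC /Ce mulrDr mulr1 mulrDl.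
  apply: lerD; first exact: F_le.
  apply: le_trans y_le _; rewrite -mulrA mulrCA ler_wpM2l//.
  by apply: le_trans e_le _; rewrite ler_wpM2l// exprS ler_piMl.
have key k := superconvergence Cf2 d01 dY h0d uE (psi := psi k) Ce0 L20 B0 P0 Q0 Ce1 rhoC
  (fun i x x01 => L2P i _ _ (Sr x x01) (hYr x x01))
  (fun i => PP (k, i)) (fun i => QP (k, i)) (BP k).
rewrite -/C6 in key.
set e := \col_i (u i).[1] - Y h.
have eE i : (u i).[1] - Y (1 * h) i 0 = e i 0 by rewrite !mxE mul1r.
have e_le : `|e| <= C6 * h ^+ (2 * s).+1 + n%:R * (N * h) * `|e|.
  apply/mx_norm_leP => [|k j].
    have Ce20 := sqr_ge0 Ce; have h0' := ltW h0.
    by rewrite /C6; do ?[apply: addr_ge0 | apply: mulr_ge0].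
  rewrite (ord1 j).
  have -> : e k 0 = \sum_i (psi k i).[h] * e i 0 -
      \sum_i (psi k i - ((k == i)%:R)%:P).[h] * e i 0.
    rewrite -sumrB (bigD1 k)//= big1 ?addr0 => [|i ik].
      by rewrite -mulrBl hornerD hornerN hornerC eqxx opprB addrC subrK mul1r.
    by rewrite eq_sym (negbTE ik) polyC0 subr0 subrr.
  apply: (le_trans (ler_normB _ _)); apply: lerD.
    by have := key k; under eq_bigr do rewrite eE.
  apply: sum_norm_le => i; last exact: mx_norm_ge_coord.
  by have := NP (k, i) h; rewrite expr1; apply; rewrite (ltW h0).
have := ler_wpM2r (normr_ge0 e) hN.
by move=> ?; rewrite -mulrA; lra.
Qed.

End LocalErrorTheorem.

(** * Order and stability of the method *)
Section Order.
Context {R : realType}.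

Lemma class_C_mulmx_grad n k (J : 'M[R]_n) (H : 'cV[R]_n -> R) i :
  class_C k.+1 H -> class_C k (fun x => (J *m grad H x) i 0).
Proof.
move=> CH; rewrite (_ : (fun x => _) = (fun x => \sum_j J i j * partial j H x)).
  apply: class_C_sum => j _; apply: class_CM; first exact: class_C_cst.
  exact: class_C_partial.
by apply/funext => x; rewrite mxE; apply: eq_bigr => j _; rewrite mxE.
Qed.

Theorem hbvm_has_order (s : nat) (c : 'I_s -> R) :
  (1 <= s)%N -> injective c -> (forall i, 0 < c i <= 1) -> hbvm_order c (2 * s).
Proof.
move=> s1 c_inj c_range m J H _ CH f t0 T y0 y T0 yt0 dy r r0 solution.
have Cf i : class_C (2 * s) (fun x => f x i 0) by exact: class_C_mulmx_grad.
have Cf1 i : class_C 1 (fun x => f x i 0).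
  by apply: class_C_le (Cf i); rewrite muln_gt0.
have cf i := continuous_class_C (Cf i).
have dy0 : is_derive t0 1 y (f (y t0)).
  by apply: dy; rewrite in_itv/= ltrDl T0 ltrBlDr ltrDl T0.
have [d0 d00 yr] : exists2 d0 : R, 0 < d0 &
    forall t, 0 <= t <= d0 -> `|y (t0 + t) - y0| <= r.
  have yc : {for t0, continuous y}.
    by apply: differentiable_continuous; apply/derivable1_diffP; case: dy0.
  move/cvgrPdist_le : yc => /(_ r r0) /nbhs_ballP[e /= e0 eP].
  exists (e / 2); first by rewrite divr_gt0.
  move=> t /andP[t_ge0 te]; rewrite -yt0 distrC; apply: eP.
  rewrite /ball/= opprD addrA subrr sub0r normrN ger0_norm//.
  by apply: le_lt_trans te _; rewrite ltr_pdivrMr// ltr_pMr// ltr1n.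
(* For 0 <= t <= d, the solution is defined at t0 + t and stays in the ball of
   radius r; d <= 1 orders the powers of h. *)
pose d := Num.min 1 (Num.min (T / 2) d0).
have d01 : 0 < d <= 1 by rewrite !lt_min ltr01 divr_gt0// d00 ge_min lexx.
have dT : d <= T / 2 by rewrite !ge_min lexx orbT.
have dd0 : d <= d0 by rewrite !ge_min lexx !orbT.
pose Y t := y (t0 + t).
have Y0 : Y 0 = y0 by rewrite /Y addr0.
have dY (t : R) : 0 <= t <= d -> is_derive t 1 Y (f (Y t)).
  move=> /andP[t_ge0 td].
  have D : is_derive (t0 + t * 1) 1 y (f (Y t)).
    rewrite mulr1; apply: dy; rewrite in_itv/= ltrD2l.
    have : t < T.
      apply: le_lt_trans td (le_lt_trans dT _).
      by rewrite ltr_pdivrMr// ltr_pMr// ltr1n.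
    by move=> tT; rewrite ltrD2l tT andbT; lra.
  have := is_derive_affine D; rewrite scale1r; congr (is_derive _ _ _ _).
  by apply/funext => z; rewrite mulr1.
have Yr t : 0 <= t <= d -> `|Y t - Y 0| <= r.
  by rewrite Y0 => /andP[t_ge0 td]; apply: yr; rewrite t_ge0 (le_trans td).
have [h1 [C [/andP[h1_gt0 h1d] errC]]] := local_error s1 Cf d01 dY Yr.
have [||M M0 MP] := @finite_bounds R _ (fun i M => forall x,
   `|x - y0| <= r -> `|f x i 0| <= M).
- by move=> i; exact: bounded_on_ball.
- by move=> i M M' MP MM' x xr; apply: le_trans (MP x xr) MM'.
have [||L L0 LP] := @finite_bounds R _ (fun i L => forall x y,
   `|x - y0| <= r -> `|y - y0| <= r -> `|f x i 0 - f y i 0| <= L * `|x - y|).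
- by move=> i; exact: lipschitz_on_ball.
- move=> i K K' KP KK' x x' xr x'r; apply: le_trans (KP x x' xr x'r) _.
  by rewrite ler_wpM2r.
have [h2 h2_gt0 ex] := hbvm_exists t0 cf c_inj c_range r0 M0 L0 MP LP.
exists (Num.min h1 h2), C; split.
- by rewrite lt_min h1_gt0.
- by rewrite gt_min (le_lt_trans h1d)// (le_lt_trans dT)// ltr_pdivrMr// ltr_pMr// ltr1n.
move=> h /andP[h_gt0]; rewrite le_min => /andP[hh1 hh2]; split.
  have [|sigma sol ball] := ex h; first by rewrite h_gt0.
  by exists sigma; split=> // tau; rewrite in_itv/= => /ball.
move=> sigma [sol ball].
have [u su uE] := (hbvm_vecP t0 y0 cf c_inj c_range sigma h_gt0).1 sol.
rewrite -[X in sigma (t0 + X)]mul1r su.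
apply: errC => [|i|x x01]; first by rewrite h_gt0.
- have -> : leg_approx s (fun x => f (\col_i (u i).[x]) i 0) =
      leg_approx s (fun x => f (sigma (t0 + x * h)) i 0).
    by apply: eq_leg_approx => x _; rewrite su.
  by rewrite Y0; exact: uE.
- by rewrite -su Y0; apply: ball; rewrite in_itv.
Qed.

End Order.

Unset Implicit Arguments.

Theorem corollary1 (R : realType) (s : nat) (c : 'I_s -> R)
    (s_ge1 : (1 <= s)%N) (c_inj : injective c)
    (c_range : forall i, 0 < c i <= 1) :
  hbvm_order c (2 * s) /\ perfectly_A_stable c.
Proof. by split; [exact: hbvm_has_order | exact: A_stable]. Qed.
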